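(* Let $R$ be a commutative Noetherian local ring, and let $M$ and $N$ be non-zero finitely generated $R$-modules such that $\operatorname{P}_R(M,N)<\infty$. If $\operatorname{G-dim}_R M<\infty$ and $\operatorname{qpd}_R N<\infty$, then $$\operatorname{P}_R(M,N)=\operatorname{G-dim}_R M=\operatorname{depth} R-\operatorname{depth} M.$$
   Context: For non-zero finitely generated $R$-modules $M,N$, $\operatorname{P}_R(M,N):=\sup\{i\ge 0:\operatorname{Ext}^i_R(M,N)\neq 0\}$. With $M^*=\operatorname{Hom}_R(M,R)$, a finitely generated $R$-module $M$ is totally reflexive if $M$ is reflexive and $\operatorname{Ext}^i_R(M,R)=0=\operatorname{Ext}^i_R(M^*,R)$ for all $i>0$. The Gorenstein dimension $\operatorname{G-dim}_R M$ is the infimum of all non-negative integers $k$ such that there is an exact sequence $0\to G_k\to\cdots\to G_0\to M\to 0$ with each $G_i$ totally reflexive. For a complex $X$ of $R$-modules (homologically indexed), $\sup X=\sup\{i: X_i\ne 0\}$, $\inf X=\inf\{i: X_i\neq 0\}$, $\operatorname{hsup}X=\sup\{i: H_i(X)\neq 0\}$. $X$ is bounded below if $\inf X>-\infty$, and bounded if $\sup X-\inf X<\infty$. A quasi-projective resolution of a finitely generated $R$-module $M$ is a bounded below complex $P$ of (finitely generated) projective $R$-modules such that for all $i\ge\inf P$ there exist non-negative integers $a_i$, not all zero, with $H_i(P)\cong M^{\oplus a_i}$. The quasi-projective dimension of $M\neq 0$ is $\operatorname{qpd}_R M=\inf\{\sup P-\operatorname{hsup}P : P \text{ is a bounded quasi-projective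 resolution of } M\}$; it is $\infty$ if $M$ has no bounded quasi-projective resolution. *)

(* Defs.v *)
From HB Require Import structures.
From mathcomp Require Import all_boot all_order all_algebra.
From mathcomp Require Import boolp classical_sets constructive_ereal ereal.
From mathcomp Require freeg.

Set Implicit Arguments.
Unset Strict Implicit.
Unset Printing Implicit Defensive.

Import Order.TTheory GRing.Theory Num.Theory.
Local Open Scope classical_set_scope.
Local Open Scope ring_scope.
Local Open Scope quotient_scope.

Section Rings.
Variable R : comNzRingType.

Definition ideal (I : set R) : Prop :=
  I 0 /\ forall a x y, I x -> I y -> I (a * x + y).

Definition noetherian : Prop :=
  forall I : set R, ideal I ->
    exists (n : nat) (g : 'I_n -> R),
      I = [set x | exists c : 'I_n -> R, x = \sum_i c i * g i].

Definition maximal_ideal (m : set R) : Prop :=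
  [/\ ideal m, ~ m 1 &
      forall I : set R, ideal I -> ~ I 1 -> m `<=` I -> I = m].

Definition local_ring (m : set R) : Prop :=
  maximal_ideal m /\ forall I : set R, maximal_ideal I -> I = m.

End Rings.

Arguments noetherian : clear implicits.

Section Modules.
Variable R : comNzRingType.
Implicit Types U V W M N : lmodType R.

Definition nonzero_module M : Prop := exists x : M, x != 0.

Definition finitely_generated M : Prop :=
  exists (n : nat) (g : 'I_n -> M),
    forall x : M, exists c : 'I_n -> R, x = \sum_i c i *: g i.

Definition surj U V (f : {linear U -> V}) : Prop :=
  forall y, exists x, f x = y.

Definition isomorphic U V : Prop :=
  exists f : {linear U -> V}, bijective f.

Definition projective (P : lmodType R) : Prop :=
  forall U V (g : {linear U -> V}) (f : {linear P -> V}),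
    surj g -> exists h : {linear P -> U}, forall x, g (h x) = f x.

End Modules.

Section HomModule.
Variables (R : comNzRingType) (U V : lmodType R).

Definition linhom : Type := {linear U -> V}.

HB.instance Definition _ := gen_eqMixin linhom.
HB.instance Definition _ := gen_choiceMixin linhom.

Lemma hom_ext (f g : linhom) : f =1 g -> f = g.
Proof.
case: f => f [[a] [b]]; case: g => g [[a'] [b']] /= fg.
have {}fg : f = g by apply/funext.
subst g.
by rewrite (Prop_irrelevance a a') (Prop_irrelevance b b').
Qed.

Definition hom0 : linhom := \0.
Definition homN (f : linhom) : linhom := \- f.
Definition homD (f g : linhom) : linhom := f \+ g.
Definition homZ (a : R) (f : linhom) : linhom := a \*: f.

Lemma homDA : associative homD.
Proof. by move=> f g h; apply: hom_ext => x /=; rewrite addrA. Qed.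
Lemma homDC : commutative homD.
Proof. by move=> f g; apply: hom_ext => x /=; rewrite addrC. Qed.
Lemma hom0D : left_id hom0 homD.
Proof. by move=> f; apply: hom_ext => x /=; rewrite add0r. Qed.
Lemma homND : left_inverse hom0 homN homD.
Proof. by move=> f; apply: hom_ext => x /=; rewrite addNr. Qed.

HB.instance Definition _ := GRing.isZmodule.Build linhom homDA homDC hom0D homND.

Lemma homZA a b f : homZ a (homZ b f) = homZ (a * b) f.
Proof. by apply: hom_ext => x /=; rewrite scalerA. Qed.
Lemma hom1Z : left_id 1 homZ.
Proof. by move=> f; apply: hom_ext => x /=; rewrite scale1r. Qed.
Lemma homZDr : right_distributive homZ +%R.
Proof. by move=> a f g; apply: hom_ext => x /=; rewrite scalerDr. Qed.
Lemma homZDl f : {morph homZ^~ f : a b / a + b}.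
Proof. by move=> a b; apply: hom_ext => x /=; rewrite scalerDl. Qed.

HB.instance Definition _ :=
  GRing.Zmodule_isLmodule.Build R linhom homZA hom1Z homZDr homZDl.

End HomModule.

Section Precomposition.
Variables (R : comNzRingType) (U V N : lmodType R) (f : {linear U -> V}).

Definition precomp (h : linhom V N) : linhom U N := h \o f.

Lemma precomp_is_linear : linear precomp.
Proof. by move=> a g h; apply: hom_ext. Qed.

HB.instance Definition _ :=
  GRing.isLinear.Build R (linhom V N) (linhom U N) *:%R precomp precomp_is_linear.

End Precomposition.

Section Dual.
Variable R : comNzRingType.

Definition dual (M : lmodType R) : lmodType R := linhom M R^o.

Definition evalfun (M : lmodType R) (x : M) (f : dual M) : R^o := f x.

Lemma evalfun_is_linear (M : lmodType R) (x : M) : linear (evalfun x).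
Proof. by []. Qed.

HB.instance Definition _ (M : lmodType R) (x : M) :=
  GRing.isLinear.Build R (dual M) R^o *:%R (evalfun x) (evalfun_is_linear x).

Definition biduality (M : lmodType R) (x : M) : dual (dual M) := evalfun x.

Definition reflexive_module (M : lmodType R) : Prop :=
  bijective (@biduality M).

End Dual.

Record submodule (R : comNzRingType) (V : lmodType R) := Submodule {
  submod_set :> V -> Prop;
  submod0 : submod_set 0;
  submodP : forall a x y,
    submod_set x -> submod_set y -> submod_set (a *: x + y)
}.

Section QuotientModule.
Variables (R : comNzRingType) (V : lmodType R) (W : submodule V).

Definition submod_pred : {pred V} := fun x => `[< W x >].

Lemma submod_pred_closed : GRing.submod_closed submod_pred.
Proof.
split=> [|a x y]; first by apply/asboolP; exact: submod0.
by move=> /asboolP Wx /asboolP Wy; apply/asboolP; exact: submodP.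
Qed.

HB.instance Definition _ :=
  GRing.isSubmodClosed.Build R V submod_pred submod_pred_closed.

Definition quotmod : Type := Quotient.quot submod_pred.

HB.instance Definition _ := GRing.Zmodule.on quotmod.

Definition quotZ (a : R) (x : quotmod) : quotmod :=
  \pi_(Quotient.quot submod_pred) (a *: repr x).

Lemma pi_quotZ a (x : V) :
  quotZ a (\pi_(Quotient.quot submod_pred) x) = \pi_(Quotient.quot submod_pred) (a *: x).
Proof.
apply/eqP; rewrite -Quotient.idealrBE -scalerBr rpredZ //.
by rewrite Quotient.idealrBE reprK.
Qed.

Lemma quotZA a b x : quotZ a (quotZ b x) = quotZ (a * b) x.
Proof. by rewrite [quotZ b x]/quotZ pi_quotZ scalerA. Qed.
Lemma quot1Z : left_id 1 quotZ.
Proof. by move=> x; rewrite /quotZ scale1r reprK. Qed.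
Lemma quotZDr : right_distributive quotZ +%R.
Proof.
move=> a x y; rewrite -[x]reprK -[y]reprK -[_ + _]raddfD !pi_quotZ.
by rewrite scalerDr raddfD.
Qed.
Lemma quotZDl x : {morph quotZ^~ x : a b / a + b}.
Proof. by move=> a b; rewrite /quotZ scalerDl raddfD. Qed.

HB.instance Definition _ :=
  GRing.Zmodule_isLmodule.Build R quotmod quotZA quot1Z quotZDr quotZDl.

End QuotientModule.

Section Kernel.
Variables (R : comNzRingType) (U V : lmodType R) (f : {linear U -> V}).

Definition inker : {pred U} := fun x => f x == 0.

Lemma inker_submod : GRing.submod_closed inker.
Proof.
split=> [|a x y]; rewrite !unfold_in ?linear0 // => /eqP fx /eqP fy.
by rewrite linearP fx fy scaler0 addr0.
Qed.

HB.instance Definition _ := GRing.isSubmodClosed.Build R U inker inker_submod.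

Record kermod : Type := Kermod { kerval :> U; _ : kerval \in inker }.

HB.instance Definition _ := [isSub for kerval].
HB.instance Definition _ := [Choice of kermod by <:].
HB.instance Definition _ := [SubChoice_isSubLmodule of kermod by <:].

End Kernel.

Section Homology.
Variables (R : comNzRingType) (U V W : lmodType R).
Variables (f : {linear U -> V}) (g : {linear V -> W}).

Definition boundary_set : set (kermod g) := [set z | exists u, f u = val z].

Lemma boundary0 : boundary_set 0.
Proof. by exists 0; rewrite !linear0. Qed.

Lemma boundaryP a x y :
  boundary_set x -> boundary_set y -> boundary_set (a *: x + y).
Proof. by move=> [u fu] [v fv]; exists (a *: u + v); rewrite !linearP fu fv. Qed.

Definition boundaries : submodule (kermod g) := Submodule boundary0 boundaryP.

(* For U -f-> V -g-> W with g \o f = 0 this is ker g / im f. *)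
Definition homology : lmodType R := quotmod boundaries.

End Homology.

Section Resolutions.
Variables (R : comNzRingType) (M : lmodType R).

(* An exact sequence ... -> X_2 -> X_1 -> X_0 -> M -> 0. *)
Record resolution := Resolution {
  res_obj :> nat -> lmodType R;
  res_diff : forall n, {linear res_obj n.+1 -> res_obj n};
  res_aug : {linear res_obj 0%N -> M};
  res_aug_surj : surj res_aug;
  res_exact0 : forall x, res_aug x = 0 <-> exists y, res_diff 0%N y = x;
  res_exact : forall n x, res_diff n x = 0 <-> exists y, res_diff n.+1 y = x
}.

Definition projective_resolution (X : resolution) : Prop :=
  forall n, projective (X n).

End Resolutions.

Section EnoughProjectives.
Import freeg.
Variable R : comNzRingType.

Definition free_on (K : choiceType) : lmodType R :=
  freeg.FreegDefs.type_of (Phant R) (Phant K).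

Section Lift.
Variables (K : choiceType) (V : lmodType R) (f : K -> V).

Definition free_lift (D : free_on K) : V := freeg.fglift f D.

Lemma free_lift_is_zmod_morphism : zmod_morphism free_lift.
Proof. exact: freeg.lift_is_additive. Qed.

HB.instance Definition _ :=
  GRing.isZmodMorphism.Build (free_on K) V free_lift free_lift_is_zmod_morphism.

Lemma free_liftU a k : free_lift (freeg.Freeg [:: (a, k)]) = a *: f k.
Proof. exact: freeg.liftU. Qed.

Lemma free_lift_is_scalable : scalable free_lift.
Proof.
move=> a D; rewrite -[LHS]/(free_lift (fgscale a D)) /fgscale.
rewrite -[D in RHS]freeg_sumE !raddf_sum.
by apply: eq_bigr => k _; rewrite /= !free_liftU scalerA.
Qed.

HB.instance Definition _ :=
  GRing.isScalable.Build R (free_on K) V *:%R free_lift free_lift_is_scalable.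

End Lift.

Lemma free_on_projective (K : choiceType) : projective (free_on K).
Proof.
move=> U V g f g_surj.
have /choice[h gh] (k : K) : exists u, g u = f (freeg.Freeg [:: (1, k)]).
  exact: g_surj.
exists (free_lift h) => D; rewrite -[D]freeg_sumE !raddf_sum.
apply: eq_bigr => k _ /=; rewrite free_liftU linearZ /= gh -linearZ.
by congr (f _); apply/eqP/freeg_eqP => x; rewrite coeffZ !coeffU mul1r.
Qed.

Variable M : lmodType R.

(* Iterated kernels of the canonical maps from free modules. *)
Fixpoint syzygy (n : nat) : lmodType R :=
  if n is n'.+1 then kermod (@free_lift (syzygy n') (syzygy n') id) else M.

Definition free_cover n : {linear free_on (syzygy n) -> syzygy n} :=
  @free_lift (syzygy n) (syzygy n) id.

Definition free_diff n :
    {linear free_on (syzygy n.+1) -> free_on (syzygy n)} :=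
  (val : {linear kermod (free_cover n) -> free_on (syzygy n)})
    \o free_cover n.+1.

Lemma free_cover_surj n : surj (free_cover n).
Proof. by move=> x; exists (Freeg [:: (1, x)]); rewrite /= free_liftU scale1r. Qed.

Lemma free_cover_exact n x :
  free_cover n x = 0 <-> exists y, free_diff n y = x.
Proof.
split=> [x0|[y <-]]; last exact/eqP/(valP (free_cover n.+1 y)).
have xK : x \in inker (free_cover n) by apply/eqP.
have [y yx] := @free_cover_surj n.+1 (Kermod xK).
by exists y; rewrite /free_diff /= yx.
Qed.

Lemma free_diff_exact n x :
  free_diff n x = 0 <-> exists y, free_diff n.+1 y = x.
Proof.
rewrite -free_cover_exact; split=> [x0|x0]; last by rewrite /free_diff /= x0.
by apply: val_inj; rewrite [RHS]raddf0.
Qed.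

Lemma projective_resolution_exists :
  exists X : resolution M, projective_resolution X.
Proof.
exists (Resolution (@free_cover_surj 0) (@free_cover_exact 0) free_diff_exact).
by move=> n; exact: free_on_projective.
Qed.

End EnoughProjectives.

Section Ext.
Variables (R : comNzRingType) (M N : lmodType R).

Definition chosen_resolution : resolution M :=
  projT1 (cid (projective_resolution_exists M)).

Lemma chosen_resolutionP : projective_resolution chosen_resolution.
Proof. exact: projT2 (cid (projective_resolution_exists M)). Qed.

(* Cohomology of 0 -> Hom(X_0, N) -> Hom(X_1, N) -> ... in degree i. *)
Definition hom_cohomology (X : resolution M) (i : nat) : lmodType R :=
  match i with
  | 0%N => homology (\0 : {linear linhom (X 0%N) N -> linhom (X 0%N) N})
                    (precomp (N := N) (res_diff X 0%N))
  | n.+1 => homology (precomp (N := N) (res_diff X n)) (precomp (N := N) (res_diff X n.+1))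
  end.

Definition Ext (i : nat) : lmodType R := hom_cohomology chosen_resolution i.

End Ext.

Section HomologicalInvariants.
Variable R : comNzRingType.
Implicit Types M N G : lmodType R.

Local Open Scope ereal_scope.

(* P_R(M, N); it is -oo when every Ext^i(M, N) vanishes. *)
Definition Ext_sup M N : \bar int :=
  supremum -oo [set (i%:Z)%:E | i in [set i : nat | nonzero_module (Ext M N i)]].

Definition totally_reflexive G : Prop :=
  [/\ finitely_generated G, reflexive_module G &
      forall i : nat, (0 < i)%N ->
        ~ nonzero_module (Ext G R^o i) /\
        ~ nonzero_module (Ext (dual G) R^o i)].

(* An exact sequence 0 -> G_k -> ... -> G_0 -> M -> 0 is encoded as a
   resolution that vanishes beyond degree k. *)
Definition Gorenstein_resolution M (k : nat) (X : resolution M) : Prop :=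
  (forall i : nat, (i <= k)%N -> totally_reflexive (X i)) /\
  (forall i : nat, (k < i)%N -> ~ nonzero_module (X i)).

Definition Gdim M : \bar int :=
  infimum +oo [set (k%:Z)%:E | k in [set k : nat |
    exists X : resolution M, Gorenstein_resolution k X]].

End HomologicalInvariants.

Section Depth.
Variables (R : comNzRingType) (m : set R) (M : lmodType R).

Section IdealMul.
Variable s : seq R.

Definition ideal_mul_set : set M :=
  [set x | exists y : 'I_(size s) -> M, x = \sum_(i < size s) s`_i *: y i].

Lemma ideal_mul0 : ideal_mul_set 0.
Proof. by exists (fun=> 0); rewrite big1 // => i _; rewrite scaler0. Qed.

Lemma ideal_mulP a x y :
  ideal_mul_set x -> ideal_mul_set y -> ideal_mul_set (a *: x + y).
Proof.
move=> [u ->] [v ->]; exists (fun i => a *: u i + v i).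
rewrite scaler_sumr -big_split; apply: eq_bigr => i _ /=.
by rewrite scalerDr !scalerA mulrC.
Qed.

(* (s)M *)
Definition ideal_mul : submodule M := Submodule ideal_mul0 ideal_mulP.

End IdealMul.

Definition regular_sequence (s : seq R) : Prop :=
  (forall i : nat, (i < size s)%N ->
     injective (fun x : quotmod (ideal_mul (take i s)) => s`_i *: x)) /\
  nonzero_module (quotmod (ideal_mul s)).

Definition depth : \bar int :=
  supremum -oo%E [set ((size s)%:Z)%:E%E | s in
    [set s : seq R | (forall a, a \in s -> m a) /\ regular_sequence s]].

End Depth.

Section Complexes.
Variable R : comNzRingType.

(* A homologically indexed complex.  Differentials are given between all pairs
   of degrees, and vanish unless the degree drops by one; this avoids
   transports along i - 1 + 1 = i. *)
Record complex := Complex {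
  cx_obj :> int -> lmodType R;
  cx_diff : forall i j : int, {linear cx_obj i -> cx_obj j};
  cx_shape : forall i j : int, i != j + 1 -> forall x, cx_diff i j x = 0;
  cx_diffK : forall (i j k : int) x, cx_diff j k (cx_diff i j x) = 0
}.

Local Open Scope ereal_scope.

Definition cx_homology (X : complex) (i : int) : lmodType R :=
  homology (cx_diff X (i + 1)%R i) (cx_diff X i (i - 1)%R).

Definition cx_sup (X : complex) : \bar int :=
  supremum -oo [set i%:E | i in [set i : int | nonzero_module (X i)]].

Definition cx_inf (X : complex) : \bar int :=
  infimum +oo [set i%:E | i in [set i : int | nonzero_module (X i)]].

Definition cx_hsup (X : complex) : \bar int :=
  supremum -oo
    [set i%:E | i in [set i : int | nonzero_module (cx_homology X i)]].

Definition bounded_below (X : complex) : Prop := -oo < cx_inf X.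

Definition bounded (X : complex) : Prop := cx_sup X - cx_inf X < +oo.

Definition quasi_projective_resolution (M : lmodType R) (P : complex) : Prop :=
  [/\ bounded_below P,
      forall i, projective (P i) /\ finitely_generated (P i) &
      exists a : int -> nat,
        (exists2 i, cx_inf P <= i%:E & a i != 0%N) /\
        (forall i, cx_inf P <= i%:E ->
           isomorphic (cx_homology P i) {ffun 'I_(a i) -> M})].

Definition qpd (M : lmodType R) : \bar int :=
  infimum +oo [set v | exists P : complex,
    [/\ quasi_projective_resolution M P, bounded P &
        v = cx_sup P - cx_hsup P]].

End Complexes.

(* Main.v *)
(* Let g = G-dim M; then Ext^i(M, R) vanishes for i > g and not for i = g.
   If d = depth R, a totally reflexive G satisfies Ext^i(k, G) = 0 for i < d and
   Ext^d(k, G) = Hom(G^*, Ext^d(k, R)), because G embeds in a free module with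
   totally reflexive cokernel. Along a resolution of M of length g by such
   modules the first nonzero Ext^i(k, M) therefore sits in degree d - g, the
   relevant kernel being Hom(Ext^g(M, R), Ext^d(k, R)); by Rees' theorem this
   degree is depth M.
   For the other equality, let P be a bounded quasi-projective resolution of N
   whose lowest nonzero homology is H_b. The module Z_b of b-cycles is projective,
   and the top nonvanishing hyperext of M with P is Ext^p(M, H_b), p = P(M, N),
   from the homology side and a quotient of Ext^g(M, Z_b), nonzero by Nakayama,
   from the projective side. Hence p = g. *)
Require Import Defs.
From HB Require Import structures.
From mathcomp Require Import all_boot all_order all_algebra.
From mathcomp Require Import boolp classical_sets constructive_ereal ereal.
From mathcomp Require Import zify.
Set Implicit Arguments.
Unset Strict Implicit.
Unset Printing Implicit Defensive.
Import GRing.Theory.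
Local Open Scope ring_scope.

(** * Short exact sequences *)

Section LinearMaps.
Variable R : comNzRingType.
Implicit Types A B C K M N P Q U V W : lmodType R.

(** Only vanishing of Ext is ever compared, so no connecting maps are built. [Ext] rests on one
    arbitrarily chosen resolution, while exact sequences are needed in both variables; vanishing is
    therefore expressed twice: [Ext_van] by lifting properties that mention no resolution, suited to
    sequences in the first variable, and [Ext_zero] by cochains on a fixed projective resolution,
    suited to the second. [Ext_zeroS] matches them in positive degrees. In the same spirit the
    isomorphism of Ext^d(k, G) with Hom(G^*, Ext^d(k, R)) is split into two usable halves:
    functionals detect coboundaries, and every map G^* -> k is realized by a cocycle. Nakayama
    supplies the maps to k. Hyperext is not formed either: its two filtrations become inductions
    along cycles and boundaries, upwards to b for projectivity of Z_b and downwards from the zero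
    top for vanishing. Finiteness of P(M, N) starts the descending induction that excludes p > g; p
    < g is excluded because it would give Ext^g(M, R) = m Ext^g(M, R). *)

Lemma lin_of_rel U V (rho : U -> V -> Prop) :
  (forall u, exists v, rho u v) ->
  (forall a u u' v v', rho u v -> rho u' v' -> rho (a *: u + u') (a *: v + v')) ->
  (forall v, rho 0 v -> v = 0) ->
  exists f : {linear U -> V}, forall u, rho u (f u).
Proof.
move=> rho_total rho_lin rho0; have [f fP] := choice rho_total.
(* The three related pairs combine to one over 0, and [rho0] kills its second entry, which is the
   defect of linearity of the chosen [f]. *)
have f_lin : linear f.
  move=> a u u'; apply/eqP; rewrite -subr_eq0; apply/eqP/rho0.
  have := rho_lin (- 1) _ _ _ _ (rho_lin a _ _ _ _ (fP u) (fP u')) (fP (a *: u + u')).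
  by rewrite !scaleN1r addNr [X in rho 0 X -> _]addrC.
pose L := GRing.isLinear.Build R U V *:%R f f_lin.
pose F : {linear U -> V} := HB.pack f L.
by exists F.
Qed.

Lemma inj_of_ker U V (f : {linear U -> V}) :
  (forall x, f x = 0 -> x = 0) -> injective f.
Proof.
move=> f0 x y fxy; apply/eqP; rewrite -subr_eq0; apply/eqP/f0.
by rewrite linearB fxy subrr.
Qed.

Lemma ker_of_inj U V (f : {linear U -> V}) x : injective f -> f x = 0 -> x = 0.
Proof. by move=> f_inj fx; apply: f_inj; rewrite linear0. Qed.

Lemma kermodP U V (f : {linear U -> V}) (x : kermod f) : f (val x) = 0.
Proof. exact/eqP/(valP x). Qed.

Lemma kermod_ex U V (f : {linear U -> V}) x :
  f x = 0 -> exists k : kermod f, val k = x.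
Proof. by move/eqP => fx; exists (Kermod (fx : x \in inker f)). Qed.

Lemma kermod_lift U V W (f : {linear U -> V}) (h : {linear W -> U}) :
  (forall w, f (h w) = 0) ->
  exists k : {linear W -> kermod f}, forall w, val (k w) = h w.
Proof.
move=> fh; apply: (@lin_of_rel W (kermod f) (fun w k => val k = h w)).
- by move=> w; exact/kermod_ex/fh.
- by move=> a u u' v v' hv hv'; rewrite linearP -hv -hv'.
- by move=> v; rewrite linear0 => hv; apply: val_inj; exact: hv.
Qed.

Definition ses A B C (i : {linear A -> B}) (p : {linear B -> C}) : Prop :=
  [/\ injective i, surj p & forall y, p y = 0 <-> exists x, i x = y].

Lemma ses_comp0 A B C (i : {linear A -> B}) (p : {linear B -> C}) x :
  ses i p -> p (i x) = 0.
Proof. by case=> _ _ ip; apply/ip; exists x. Qed.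

Lemma ses_kermod U V (f : {linear U -> V}) :
  surj f -> ses (val : {linear kermod f -> U}) f.
Proof.
move=> f_surj; split=> // [x y|y]; first exact: val_inj.
by split=> [/kermod_ex|[x <-]]; last exact: kermodP.
Qed.

Lemma ses_desc A B C (i : {linear A -> B}) (p : {linear B -> C}) N
    (f : {linear B -> N}) :
  ses i p -> (forall x, f (i x) = 0) ->
  exists g : {linear C -> N}, forall y, g (p y) = f y.
Proof.
move=> [i_inj p_surj ip] fi.
have [|||g gP] := @lin_of_rel C N (fun z v => exists2 y, p y = z & f y = v).
- by move=> z; have [y <-] := p_surj z; exists (f y), y.
- move=> a u u' v v' [y <- <-] [y' <- <-].
  by exists (a *: y + y'); rewrite linearP.
- by move=> v [y /ip[x <-] <-].
exists g => y; have [y' pyy' <-] := gP (p y).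
have /ip[x xy] : p (y - y') = 0 by rewrite linearB pyy' subrr.
by apply/eqP; rewrite eq_sym -subr_eq0 -linearB -xy fi.
Qed.

Lemma ses_lift A B C (i : {linear A -> B}) (p : {linear B -> C}) W
    (f : {linear W -> B}) :
  ses i p -> (forall w, p (f w) = 0) ->
  exists g : {linear W -> A}, forall w, i (g w) = f w.
Proof.
move=> [i_inj p_surj ip] pf; apply: (@lin_of_rel W A (fun w v => i v = f w)).
- by move=> w; exact/ip/pf.
- by move=> a u u' v v' iv iv'; rewrite !linearP iv iv'.
- by move=> v; rewrite linear0; exact: ker_of_inj.
Qed.

(** [Q] is the fibre product of [B] and [P] over [C]. It compares a presentation of [C] with [B] and
    is the device behind every exact sequence in the first variable of Ext. *)
Lemma ses_pullback A B C K P (i : {linear A -> B}) (p : {linear B -> C})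
    (j : {linear K -> P}) (q : {linear P -> C}) :
  ses i p -> ses j q ->
  exists (Q : lmodType R) (u : {linear Q -> B}) (v : {linear Q -> P})
         (i' : {linear A -> Q}) (j' : {linear K -> Q}),
    [/\ ses i' v, ses j' u, forall x, u (i' x) = i x & forall x, v (j' x) = j x].
Proof.
move=> [i_inj p_surj ip] [j_inj q_surj jq].
pose D : {linear (B * P)%type -> C} := (p \o fst) \- (q \o snd).
pose u : {linear kermod D -> B} := fst \o val.
pose v : {linear kermod D -> P} := snd \o val.
have pair b y : p b = q y -> exists x, u x = b /\ v x = y.
  move=> pq; have [|k kE] := @kermod_ex _ _ D (b, y).
    by rewrite -[LHS]/(p b - q y) pq subrr.
  by exists k; rewrite /u /v /= kE.
have joint x : u x = 0 -> v x = 0 -> x = 0.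
  rewrite /u /v /= => ux vx; apply: val_inj; rewrite linear0 /=.
  by move: ux vx; case: (val x) => b y /= -> ->.
have puqv x : p (u x) = q (v x).
  have := kermodP x; rewrite /u /v /=; case: (val x) => b y.
  by move=> /= /eqP; rewrite subr_eq0 => /eqP.
have [i'0 i'0P] : exists i' : {linear A -> (B * P)%type}, forall x, i' x = (i x, 0).
  apply: (@lin_of_rel A _ (fun x z => z = (i x, 0))) => [w|a w w' z z' -> ->|z ->].
  - by eexists.
  - by rewrite linearP -[LHS]/(a *: i w + i w', a *: 0 + 0) scaler0 addr0.
  - by rewrite linear0.
have [j'0 j'0P] : exists j' : {linear K -> (B * P)%type}, forall x, j' x = (0, j x).
  apply: (@lin_of_rel K _ (fun x z => z = (0, j x))) => [w|a w w' z z' -> ->|z ->].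
  - by eexists.
  - by rewrite linearP -[LHS]/(a *: 0 + 0, a *: j w + j w') scaler0 addr0.
  - by rewrite linear0.
have [|i' i'P] := @kermod_lift _ _ _ D i'0.
  by move=> w; rewrite i'0P -[LHS]/(p (i w) - q 0) linear0 subr0; apply/ip; exists w.
have [|j' j'P] := @kermod_lift _ _ _ D j'0.
  by move=> w; rewrite j'0P -[LHS]/(p 0 - q (j w)) linear0 sub0r; apply/eqP; rewrite oppr_eq0; apply/eqP/jq; exists w.
have ui' x : u (i' x) = i x by rewrite /u /= i'P i'0P.
have vi' x : v (i' x) = 0 by rewrite /v /= i'P i'0P.
have uj' x : u (j' x) = 0 by rewrite /u /= j'P j'0P.
have vj' x : v (j' x) = j x by rewrite /v /= j'P j'0P.
exists (kermod D), u, v, i', j'; split=> //; split.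
- by move=> x y /(congr1 u); rewrite !ui' => /i_inj.
- by move=> y; have [b pb] := p_surj (q y); have [x [_]] := pair _ _ pb; exists x.
- move=> y; split=> [vy|[x <-]//].
  have /ip[x xu] : p (u y) = 0 by rewrite puqv vy linear0.
  exists x; apply/eqP; rewrite -subr_eq0; apply/eqP/joint.
    by rewrite linearB ui' xu subrr.
  by rewrite linearB vi' vy subrr.
- by move=> x y /(congr1 v); rewrite !vj' => /j_inj.
- by move=> y; have [b pb] := q_surj (p y); have [x []] := pair _ _ (esym pb); exists x.
- move=> y; split=> [uy|[x <-]//].
  have /jq[x xv] : q (v y) = 0 by rewrite -puqv uy linear0.
  exists x; apply/eqP; rewrite -subr_eq0; apply/eqP/joint.
    by rewrite linearB uj' uy subrr.
  by rewrite linearB vj' xv subrr.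
Qed.

(* The filtration of V induced by U <= ker (V -> C) <= V. *)
Lemma ses_comp U V A B C (mu : {linear U -> V}) (nu : {linear V -> B})
    (i : {linear A -> B}) (p : {linear B -> C}) :
  ses mu nu -> ses i p ->
  exists (V' : lmodType R) (k : {linear V' -> V}) (mu' : {linear U -> V'})
         (nu' : {linear V' -> A}),
    [/\ ses k (p \o nu), ses mu' nu' & forall x, k (mu' x) = mu x].
Proof.
move=> hmu hi; have [mu_inj nu_surj munu] := hmu; have [i_inj p_surj ip] := hi.
have pnu_surj : surj (p \o nu).
  by move=> z; have [y <-] := p_surj z; have [x <-] := nu_surj y; exists x.
have [|mu' mu'P] := @kermod_lift _ _ _ (p \o nu) mu.
  by move=> x /=; rewrite (ses_comp0 x hmu) linear0.
have [|nu' nu'P] := ses_lift (f := nu \o (val : {linear kermod (p \o nu) -> V})) hi.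
  by move=> w; exact: kermodP w.
exists (kermod (p \o nu)), val, mu', nu'; split => //; first exact: ses_kermod.
split=> [x y /(congr1 val)|a|y].
- by rewrite !mu'P => /mu_inj.
- have [x xa] := nu_surj (i a).
  have [|k kx] := @kermod_ex _ _ (p \o nu) x; first by rewrite /= xa; apply/ip; exists a.
  by exists k; apply: i_inj; rewrite nu'P /= kx.
- split=> [nuy|[x <-]]; last by apply: i_inj; rewrite nu'P /= mu'P (ses_comp0 x hmu) linear0.
  have /munu[x xy] : nu (val y) = 0 by rewrite -[LHS]nu'P nuy linear0.
  by exists x; apply: val_inj; rewrite mu'P.
Qed.

Lemma projective_prod U V : projective U -> projective V -> projective (U * V)%type.
Proof.
move=> hU hV A B g f g_surj.
have [h1 h1P] : exists h : {linear U -> (U * V)%type}, forall x, h x = (x, 0).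
  apply: (@lin_of_rel U _ (fun x z => z = (x, 0))) => [w|a w w' z z' -> ->|z ->//].
  - by eexists.
  - by rewrite -[LHS]/(a *: w + w', a *: 0 + 0) scaler0 addr0.
have [h2 h2P] : exists h : {linear V -> (U * V)%type}, forall x, h x = (0, x).
  apply: (@lin_of_rel V _ (fun x z => z = (0, x))) => [w|a w w' z z' -> ->|z ->//].
  - by eexists.
  - by rewrite -[LHS]/(a *: 0 + 0, a *: w + w') scaler0 addr0.
have [k1 k1P] := hU _ _ g (f \o h1) g_surj.
have [k2 k2P] := hV _ _ g (f \o h2) g_surj.
exists ((k1 \o fst) \+ (k2 \o snd)) => -[x y] /=.
rewrite linearD k1P k2P /= -linearD h1P h2P.
by rewrite -[(x, 0) + (0, y)]/(x + 0, 0 + y) addr0 add0r.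
Qed.

Lemma surj_projective_split U P (f : {linear U -> P}) :
  projective P -> surj f -> exists s : {linear P -> U}, forall x, f (s x) = x.
Proof. by move=> hP f_surj; exact: (hP _ _ f idfun f_surj). Qed.

Lemma projective_retract P Q (r : {linear Q -> P}) (s : {linear P -> Q}) :
  projective Q -> (forall x, r (s x) = x) -> projective P.
Proof.
move=> hQ rs U V g f g_surj; have [h hP] := hQ _ _ g (f \o r) g_surj.
by exists (h \o s) => x /=; rewrite hP /= rs.
Qed.

(* A cover of a direct sum A + P obtained from a cover of A. *)
Lemma ses_sum_cover U V A Q P (mu : {linear U -> V}) (nu : {linear V -> A})
    (i : {linear A -> Q}) (q : {linear Q -> P}) :
  ses mu nu -> ses i q -> projective P ->
  exists (T : lmodType R) (k : {linear V -> T}) (mu' : {linear U -> T})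
         (nu' : {linear T -> Q}),
    [/\ ses mu' nu', forall x, mu' x = k (mu x) &
        projective V -> projective T].
Proof.
move=> hmu hi hP; have [mu_inj nu_surj munu] := hmu; have [i_inj q_surj iq] := hi.
have [s qs] := surj_projective_split hP q_surj.
have [k kP] : exists h : {linear V -> (V * P)%type}, forall x, h x = (x, 0).
  apply: (@lin_of_rel V _ (fun x z => z = (x, 0))) => [w|a w w' z z' -> ->|z ->//].
  - by eexists.
  - by rewrite -[LHS]/(a *: w + w', a *: 0 + 0) scaler0 addr0.
exists (V * P)%type, k, (k \o mu), ((i \o nu \o fst) \+ (s \o snd)).
split=> //; last by move=> hV; exact: projective_prod.
split=> [x y /=|z|[x y] /=].
- by rewrite !kP => -[/mu_inj].
- have /iq[a az] : q (z - s (q z)) = 0 by rewrite linearB qs subrr.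
  have [x xa] := nu_surj a.
  by exists (x, q z); rewrite /= xa az subrK.
- split=> [h|[u]]; last first.
    by rewrite kP => -[<- <-]; rewrite (ses_comp0 u hmu) !linear0 addr0.
  have y0 : y = 0.
    by have := congr1 q h; rewrite linearD linear0 (ses_comp0 _ hi) qs add0r.
  move: h; rewrite y0 linear0 addr0 => /(ker_of_inj i_inj)/munu[u <-].
  by exists u; rewrite kP.
Qed.

End LinearMaps.

(** * Vanishing of Ext without resolutions *)

Section ExtVanishing.
Variables (R : comNzRingType) (N : lmodType R).
Implicit Types A B C K L M P Q U V W : lmodType R.

(* Ext_van n M says Ext^(n+1)(M, N) = 0, with no resolution chosen. *)
Fixpoint Ext_van (n : nat) M : Prop :=
  if n is n'.+1 then
    forall K P (j : {linear K -> P}) (q : {linear P -> M}),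
      ses j q -> projective P -> Ext_van n' K
  else
    forall A B (i : {linear A -> B}) (p : {linear B -> M}), ses i p ->
      forall f : {linear A -> N}, exists g : {linear B -> N}, forall x, g (i x) = f x.

Lemma projective_cover M :
  exists K P (j : {linear K -> P}) (q : {linear P -> M}), ses j q /\ projective P.
Proof.
exists (kermod (free_cover M 0)), (free_on R M), val, (free_cover M 0).
by split; [exact/ses_kermod/free_cover_surj | exact: free_on_projective].
Qed.

Lemma ses_projective_projective K P Q (j : {linear K -> P}) (q : {linear P -> Q}) :
  ses j q -> projective P -> projective Q -> projective K.
Proof.
move=> hj hP hQ; have [j_inj q_surj jq] := hj.
have [s qs] := surj_projective_split hQ q_surj.
have [|r rP] := ses_lift (f := idfun \- (s \o q)) hj.
  by move=> x /=; rewrite linearB /= qs subrr.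
apply: (projective_retract (r := r) (s := j) hP) => x.
by apply: j_inj; rewrite rP /= (ses_comp0 x hj) linear0 subr0.
Qed.

Lemma Ext_van_projective n P : projective P -> Ext_van n P.
Proof.
elim: n P => [|n IHn] P hP /=; last first.
  by move=> K Q j q hj hQ; apply: IHn; exact: ses_projective_projective hj hQ hP.
move=> A B i p hi f; have [i_inj p_surj ip] := hi.
have [s ps] := surj_projective_split hP p_surj.
have [|r rP] := ses_lift (f := idfun \- (s \o p)) hi.
  by move=> x /=; rewrite linearB /= ps subrr.
exists (f \o r) => x /=; congr (f _); apply: i_inj.
by rewrite rP /= (ses_comp0 x hi) linear0 subr0.
Qed.

Lemma Ext_van_ext0 A B C (i : {linear A -> B}) (p : {linear B -> C}) :
  ses i p -> Ext_van 0 A -> Ext_van 0 C -> Ext_van 0 B.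
Proof.
move=> hi hA hC U V mu nu hmu f.
have [V' [k [mu' [nu' [hk hmu' kmu']]]]] := ses_comp hmu hi.
have [g gP] := hA _ _ _ _ hmu' f.
have [h hP] := hC _ _ _ _ hk g.
by exists h => x; rewrite -kmu' hP gP.
Qed.

(** [Q] is [A] plus a projective, so an extension or cover of [A] becomes one of [Q] with the same
    kernel. *)
Lemma Ext_van_summand n A Q P (i : {linear A -> Q}) (q : {linear Q -> P}) :
  ses i q -> projective P -> Ext_van n Q -> Ext_van n A.
Proof.
move=> hi hP; case: n => [|n] /= hQ.
  move=> U V mu nu hmu f.
  have [T [k [mu' [nu' [hmu' mu'P _]]]]] := ses_sum_cover hmu hi hP.
  have [g gP] := hQ _ _ _ _ hmu' f.
  by exists (g \o k) => x /=; rewrite -mu'P gP.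
move=> K V mu nu hmu hV.
have [T [k [mu' [nu' [hmu' _ /(_ hV) hT]]]]] := ses_sum_cover hmu hi hP.
exact: hQ hmu' hT.
Qed.

(* Both statements are proved together: the extension property in degree n + 1
   uses the kernel property in degree n, which in turn uses the former. *)
Lemma Ext_van_ext_ker n A B C (i : {linear A -> B}) (p : {linear B -> C}) :
  ses i p ->
  (Ext_van n A -> Ext_van n C -> Ext_van n B) /\
  (Ext_van n B -> Ext_van n.+1 C -> Ext_van n A).
Proof.
elim: n A B C i p => [|n IHn] A B C i p hi.
  split=> [hA hC|hB hC]; first exact: (Ext_van_ext0 hi hA hC).
  (* The fibre product [Q] is both [A] plus a projective and an extension of [B] by the syzygy
     [K]. *)
  have [K [P [j [q [hj hP]]]]] := projective_cover C.
  have [Q [u [v [i' [j' [hi' hj' _ _]]]]]] := ses_pullback hi hj.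
  apply: (Ext_van_summand hi' hP).
  exact: (Ext_van_ext0 hj' (hC _ _ _ _ hj hP) hB).
have ext A1 B1 C1 (i1 : {linear A1 -> B1}) (p1 : {linear B1 -> C1}) : ses i1 p1 ->
    Ext_van n.+1 A1 -> Ext_van n.+1 C1 -> Ext_van n.+1 B1.
  move=> hi1 hA hC K P j q hj hP.
  have [V' [k [mu' [nu' [hk hmu' _]]]]] := ses_comp hj hi1.
  apply: (IHn _ _ _ _ _ hmu').2 => //.
  exact: hC hk hP.
split=> [hA hC|hB hC]; first exact: (ext _ _ _ _ _ hi hA hC).
have [K [P [j [q [hj hP]]]]] := projective_cover C.
have [Q [u [v [i' [j' [hi' hj' _ _]]]]]] := ses_pullback hi hj.
apply: (Ext_van_summand hi' hP).
exact: (ext _ _ _ _ _ hj' (hC _ _ _ _ hj hP) hB).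
Qed.

Lemma Ext_van_ext n A B C (i : {linear A -> B}) (p : {linear B -> C}) :
  ses i p -> Ext_van n A -> Ext_van n C -> Ext_van n B.
Proof. by move=> hi; have [] := Ext_van_ext_ker n hi. Qed.

Lemma Ext_van_ker n A B C (i : {linear A -> B}) (p : {linear B -> C}) :
  ses i p -> Ext_van n B -> Ext_van n.+1 C -> Ext_van n A.
Proof. by move=> hi; have [] := Ext_van_ext_ker n hi. Qed.

Lemma Ext_van_coker n A B C (i : {linear A -> B}) (p : {linear B -> C}) :
  ses i p -> Ext_van n A -> Ext_van n.+1 B -> Ext_van n.+1 C.
Proof.
move=> hi hA hB K P j q hj hP.
have [Q [u [v [i' [j' [hi' hj' _ _]]]]]] := ses_pullback hi hj.
apply: Ext_van_ker hj' _ hB.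
by apply: Ext_van_ext hi' hA _; exact: Ext_van_projective.
Qed.

(** A single projective presentation thus suffices to test the universally quantified definition. *)
Lemma Ext_van_shift n K P M (j : {linear K -> P}) (q : {linear P -> M}) :
  ses j q -> projective P -> Ext_van n.+1 M <-> Ext_van n K.
Proof.
move=> hj hP; split=> h; first exact: h hj hP.
by apply: Ext_van_coker hj h _; exact: Ext_van_projective.
Qed.

(** The stretch Hom(B, N) -> Hom(A, N) -> Ext^1(C, N) -> Ext^1(B, N) of the long exact sequence,
    with its first map onto. *)
Lemma Ext_van_coker0 A B C (i : {linear A -> B}) (p : {linear B -> C}) :
  ses i p ->
  (forall f : {linear A -> N}, exists g : {linear B -> N}, forall x, g (i x) = f x) ->
  Ext_van 0 B -> Ext_van 0 C.
Proof.
move=> hi hext hB U V mu nu hmu f.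
have [Q [u [v [i' [j' [hi' hj' ui' vj']]]]]] := ses_pullback hi hmu.
(* [F] extends [f] to the fibre product; subtracting [H \o u] makes it vanish on [A], so that it
   descends to [V]. *)
have [F FP] := hB _ _ _ _ hj' f.
have [H HP] := hext (F \o i').
have [|g gP] := ses_desc (f := F \- (H \o u)) hi'.
  by move=> x /=; rewrite ui' HP /= subrr.
by exists g => x; rewrite -vj' gP /= (ses_comp0 _ hj') linear0 subr0.
Qed.

Lemma Ext_van_iso n A B (f : {linear A -> B}) :
  bijective f -> Ext_van n A -> Ext_van n B.
Proof.
move=> f_bij hA; have [g fK gK] := f_bij.
pose Z : lmodType R := kermod (idfun : {linear R^o -> R^o}).
have Z0 (z : Z) : z = 0.
  by apply: val_inj; exact: (kermodP z).
have hZ : projective Z.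
  move=> U V u v u_surj; exists \0 => x; rewrite (Z0 x) !linear0 //.
have hi : ses f (\0 : {linear B -> Z}).
  split=> [|z|y]; first exact: can_inj fK.
    by exists 0; rewrite (Z0 z).
  by split=> // _; exists (g y); rewrite gK.
exact: Ext_van_ext hi hA (Ext_van_projective n hZ).
Qed.

End ExtVanishing.

(** * Quotient maps and nonvanishing of homology *)

Section Quotients.
Variable R : comNzRingType.
Implicit Types U V W : lmodType R.

Definition quot_pi V (S : submodule V) (x : V) : quotmod S :=
  (\pi_(Quotient.quot (submod_pred S)) x)%qT.

Lemma quot_pi_is_linear V (S : submodule V) : linear (quot_pi S).
Proof. by move=> a x y; rewrite /quot_pi raddfD; congr (_ + _); exact: esym (pi_quotZ S a x). Qed.

HB.instance Definition _ V (S : submodule V) :=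
  GRing.isLinear.Build R V (quotmod S) *:%R (quot_pi S) (quot_pi_is_linear S).

Lemma quot_pi_eq0 V (S : submodule V) x : quot_pi S x = 0 <-> S x.
Proof.
have -> : (quot_pi S x = 0) <-> (quot_pi S x == quot_pi S 0).
  by rewrite [quot_pi S 0]linear0; split=> /eqP.
by rewrite /quot_pi -Quotient.idealrBE subr0; split=> /asboolP.
Qed.

Lemma quot_pi_surj V (S : submodule V) : surj (quot_pi S).
Proof. by move=> y; exists (repr y); exact: reprK. Qed.

Lemma homology_nonzero U V W (f : {linear U -> V}) (g : {linear V -> W}) :
  nonzero_module (homology f g) <-> exists z, g z = 0 /\ ~ exists u, f u = z.
Proof.
split=> [[h]|[z [gz zf]]].
  have [z <-] := quot_pi_surj h => /eqP hz.
  exists (val z); split; first exact: kermodP.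
  by move=> [u uz]; apply/hz/quot_pi_eq0; exists u.
have [k kz] := kermod_ex gz.
exists (quot_pi (boundaries f g) k); apply/eqP => /quot_pi_eq0[u uz].
by apply: zf; exists u; rewrite uz.
Qed.

Lemma nonzeroPn V : ~ nonzero_module V <-> forall x : V, x = 0.
Proof.
split=> [h x|h [x]]; last by rewrite (h x) eqxx.
by apply/eqP/negPn/negP => x0; apply: h; exists x.
Qed.

End Quotients.

(** * Ext by cochains *)

Section Cochains.
Variables (R : comNzRingType) (M : lmodType R) (X : resolution M).
Implicit Types A B C N P : lmodType R.

Definition cocycle N i (f : {linear X i -> N}) : Prop :=
  forall y, f (res_diff X i y) = 0.

Definition coboundary N i : {linear X i -> N} -> Prop :=
  if i is j.+1 then
    fun f => exists g : {linear X j -> N}, forall x, f x = g (res_diff X j x)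
  else fun f => forall x, f x = 0.

Definition Ext_zero N i : Prop :=
  forall f : {linear X i -> N}, cocycle f -> coboundary f.

Lemma res_diffK i x : res_diff X i (res_diff X i.+1 x) = 0.
Proof. by apply/res_exact; exists x. Qed.

Lemma coboundary_comb N i a (f g h : {linear X i -> N}) :
  (forall x, h x = a *: f x + g x) -> coboundary f -> coboundary g -> coboundary h.
Proof.
case: i f g h => [|i] f g h hE /=.
  by move=> f0 g0 x; rewrite hE f0 g0 scaler0 addr0.
move=> [f' fP] [g' gP]; exists ((a \*: f') \+ g') => x /=.
by rewrite hE fP gP.
Qed.

Lemma coboundary_eq N i (f g : {linear X i -> N}) :
  f =1 g -> coboundary f -> coboundary g.
Proof.
case: i f g => [|i] f g fg /=; first by move=> f0 x; rewrite -fg f0.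
by move=> [f' fP]; exists f' => x; rewrite -fg fP.
Qed.

Lemma cocycle_comp N P i (u : {linear N -> P}) (f : {linear X i -> N}) :
  cocycle f -> cocycle (u \o f).
Proof. by move=> cf y /=; rewrite cf linear0. Qed.

Lemma coboundary_comp N P i (u : {linear N -> P}) (f : {linear X i -> N}) :
  coboundary f -> coboundary (u \o f).
Proof.
case: i f => [|i] f /=; first by move=> f0 x; rewrite f0 linear0.
by move=> [f' fP]; exists (u \o f') => x; rewrite fP.
Qed.

Lemma hom_cohomology_nonzero N i :
  nonzero_module (hom_cohomology N X i) <-> ~ Ext_zero N i.
Proof.
case: i => [|i]; rewrite homology_nonzero.
  split=> [[z [cz z0]] h|h].
    apply: z0; exists 0; apply: hom_ext => x /=.
    by rewrite h // => y; have /(congr1 (fun u : linhom _ _ => u y)) := cz.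
  apply: contrapT => h'; apply: h => f cf x.
  apply: contrapT => fx; apply: h'; exists (f : linhom _ _); split.
    by apply: hom_ext => y; exact: cf.
  by move=> [u] uf; apply: fx; rewrite -uf.
split=> [[z [cz z0]] h|h].
  apply: z0; have [|g gP] := h z.
    by move=> y; have /(congr1 (fun u : linhom _ _ => u y)) := cz.
  by exists (g : linhom _ _); apply: hom_ext => x /=; rewrite gP.
apply: contrapT => h'; apply: h => f cf.
apply: contrapT => fx; apply: h'; exists (f : linhom _ _); split.
  by apply: hom_ext => y; exact: cf.
by move=> [u uf]; apply: fx; exists (u : {linear _ -> _}) => x; rewrite -uf.
Qed.

Hypothesis X_proj : projective_resolution X.

(** Exactness at Ext^i(M, B) on cochains: a potential of [b \o f] lifts through [b] because [X] is
    projective, and subtracting the differential of the lift moves [f] into [A]. *)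
Lemma cocycle_lift A B C i (a : {linear A -> B}) (b : {linear B -> C})
    (f : {linear X i -> B}) :
  ses a b -> cocycle f -> coboundary (b \o f) ->
  exists2 f' : {linear X i -> A}, cocycle f' &
    exists2 e : {linear X i -> B}, coboundary e & forall x, f x = a (f' x) + e x.
Proof.
move=> hab cf; have [a_inj b_surj ab] := hab.
case: i f cf => [|i] f cf /= cbf.
  have [f' f'P] := ses_lift hab cbf.
  exists f'; first by move=> y; apply: a_inj; rewrite f'P cf linear0.
  by exists \0 => // x; rewrite addr0 f'P.
have [g gP] := cbf; have [G GP] := X_proj g b_surj.
have [|f' f'P] := ses_lift (f := f \- (G \o res_diff X i)) hab.
  by move=> x /=; rewrite linearB /= GP gP subrr.
exists f'.
  by move=> y; apply: a_inj; rewrite f'P /= res_diffK cf !linear0 addr0.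
exists (G \o res_diff X i); first by exists G.
by move=> x; rewrite f'P /= subrK.
Qed.

(** Exactness at Ext^i(M, C): the differential of a lift of [f] to [B] lies in [A] and represents
    the connecting class; its potential corrects the lift. *)
Lemma cocycle_connect A B C i (a : {linear A -> B}) (b : {linear B -> C})
    (f : {linear X i -> C}) :
  ses a b -> Ext_zero A i.+1 -> cocycle f ->
  exists2 f' : {linear X i -> B}, cocycle f' & forall x, b (f' x) = f x.
Proof.
move=> hab hA cf; have [a_inj b_surj ab] := hab.
have [F FP] := X_proj f b_surj.
have [|d dP] := ses_lift (f := F \o res_diff X i) hab.
  by move=> x /=; rewrite FP cf.
have [|g gP] := hA d.
  by move=> y; apply: a_inj; rewrite dP /= res_diffK !linear0.
exists (F \- (a \o g)) => [y|x] /=.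
  by rewrite -gP dP subrr.
by rewrite linearB /= FP (ses_comp0 _ hab) subr0.
Qed.

(** Exactness at Ext^i(M, A). The hypothesis over [j] with [i = j.+1] reads Ext^(i-1)(M, C) = 0 and
    is void in degree 0. *)
Lemma coboundary_pull A B C i (a : {linear A -> B}) (b : {linear B -> C})
    (f : {linear X i -> A}) :
  ses a b -> (forall j, i = j.+1 -> Ext_zero C j) ->
  coboundary (a \o f) -> coboundary f.
Proof.
move=> hab; have [a_inj b_surj ab] := hab.
case: i f => [|i] f hC /=.
  by move=> af x; apply: ker_of_inj (af x).
have {}hC := hC _ erefl; move=> [g gP].
have /hC : cocycle (b \o g).
  by move=> y /=; rewrite -gP (ses_comp0 _ hab).
case: i f g gP {hC} => [|i] f g gP /= cbg.
  have [g' g'P] := ses_lift hab cbg.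
  by exists g' => x; apply: a_inj; rewrite gP g'P.
have [h hP] := cbg; have [H HP] := X_proj h b_surj.
have [|g' g'P] := ses_lift (f := g \- (H \o res_diff X i)) hab.
  by move=> x /=; rewrite linearB /= HP hP subrr.
by exists g' => x; apply: a_inj; rewrite gP g'P /= res_diffK linear0 subr0.
Qed.

Lemma Ext_zero_ext A B C i (a : {linear A -> B}) (b : {linear B -> C}) :
  ses a b -> Ext_zero A i -> Ext_zero C i -> Ext_zero B i.
Proof.
move=> hab hA hC f cf.
have [f' cf' [e ce fE]] := cocycle_lift hab cf (hC _ (cocycle_comp b cf)).
apply: (coboundary_comb (a := 1)) (coboundary_comp a (hA _ cf')) ce => x.
by rewrite scale1r fE.
Qed.

Lemma Ext_zero_coker A B C i (a : {linear A -> B}) (b : {linear B -> C}) :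
  ses a b -> Ext_zero B i -> Ext_zero A i.+1 -> Ext_zero C i.
Proof.
move=> hab hB hA f cf; have [f' cf' f'E] := cocycle_connect hab hA cf.
by apply: coboundary_eq (coboundary_comp b (hB _ cf')) => x /=; rewrite f'E.
Qed.

Lemma Ext_zero_ker A B C i (a : {linear A -> B}) (b : {linear B -> C}) :
  ses a b -> Ext_zero B i -> (forall j, i = j.+1 -> Ext_zero C j) -> Ext_zero A i.
Proof.
move=> hab hB hC f cf; apply: coboundary_pull hab hC _.
exact/hB/cocycle_comp.
Qed.

Lemma Ext_zero_retract A B i (r : {linear B -> A}) (s : {linear A -> B}) :
  (forall x, r (s x) = x) -> Ext_zero B i -> Ext_zero A i.
Proof.
move=> rs hB f cf.
by apply: coboundary_eq (coboundary_comp r (hB _ (cocycle_comp s cf))) => x /=.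
Qed.

Lemma Ext_zero_triv A i : (forall x : A, x = 0) -> Ext_zero A i.
Proof.
move=> A0 f _; case: i f => [|i] f /= => [x|]; first exact: A0.
by exists \0 => x; exact: A0.
Qed.

Lemma coboundary_ffun A n i (f : {linear X i -> {ffun 'I_n -> A}}) :
  (forall k (g : {linear X i -> A}), (forall x, g x = f x k) -> coboundary g) ->
  coboundary f.
Proof.
move=> hf.
have pr k : exists p : {linear {ffun 'I_n -> A} -> A}, forall x, p x = x k.
  apply: (@lin_of_rel _ {ffun 'I_n -> A} A (fun x y => y = x k)) => [x|a x x' y y' -> ->|y ->].
  - by eexists.
  - by rewrite !ffunE.
  - by rewrite ffunE.
have [p pP] := choice pr.
have cpf k : coboundary (p k \o f) by apply: (hf k) => x; rewrite /= pP.
case: i f {hf} cpf => [|i] f /= cpf.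
  by move=> x; apply/ffunP => k; rewrite ffunE -pP; exact: cpf.
have [g gP] := choice cpf.
have [G GP] : exists G : {linear X i -> {ffun 'I_n -> A}}, forall x, G x = [ffun k => g k x].
  apply: (@lin_of_rel _ (X i) {ffun 'I_n -> A} (fun x y => y = [ffun k => g k x])) => [x|a x x' y y' -> ->|y ->].
  - by eexists.
  - by apply/ffunP => k; rewrite !ffunE linearP.
  - by apply/ffunP => k; rewrite !ffunE linear0.
by exists G => x; apply/ffunP => k; rewrite GP ffunE -gP /= pP.
Qed.

Lemma Ext_zero_ffun A n i : Ext_zero A i -> Ext_zero {ffun 'I_n -> A} i.
Proof.
move=> hA f cf; apply: coboundary_ffun => k g gE; apply: hA => y.
by rewrite gE cf ffunE.
Qed.

Lemma Ext_zero_Hom N :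
  Ext_zero N 0 <-> forall (f : {linear M -> N}) x, f x = 0.
Proof.
split=> [h f x|h f cf x].
  have [y <-] := res_aug_surj X x.
  have cf : cocycle (f \o res_aug X).
    by move=> y' /=; rewrite (iffRL (@res_exact0 _ _ X _)) ?linear0 //; exists y'.
  exact: h _ cf y.
have [|g gP] := ses_desc (f := f) (ses_kermod (@res_aug_surj _ _ X)).
  by move=> k; have /res_exact0[y yk] := kermodP k; exact: etrans (congr1 f (esym yk)) (cf y).
by rewrite -gP h.
Qed.

End Cochains.

(** * Independence of Ext of the projective resolution *)

Section ExtVanCochains.
Variables (R : comNzRingType) (N : lmodType R).
Implicit Types M : lmodType R.

Definition first_syzygy M (X : resolution M) := kermod (res_aug X).

(** The shift holds only in positive degrees of [Y]: a 1-coboundary of [X] has to extend to X_0,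
    whereas a 0-coboundary of [Y] has to vanish. *)
Lemma syzygy_tail M (X : resolution M) :
  exists Y : resolution (first_syzygy X),
    (forall n, Y n = X n.+1) /\
    forall n, Ext_zero Y N n.+1 <-> Ext_zero X N n.+2.
Proof.
have [|e eP] := kermod_lift (f := res_aug X) (h := res_diff X 0).
  by move=> y; apply/res_exact0; exists y.
have e_surj : surj e.
  move=> k; have /res_exact0[y yk] := kermodP k.
  by exists y; apply: val_inj; rewrite eP.
have ex0 x : e x = 0 <-> exists y, res_diff X 1 y = x.
  by rewrite -res_exact -eP; split=> [->|h]; [exact: linear0|exact: val_inj].
by exists (Resolution e_surj ex0 (fun n => @res_exact _ _ X n.+1));
by split=> // n; split.
Qed.

(** The right side does not mention [X], whence independence of the resolution. In the base case
    1-cocycles are maps out of the first syzygy, and coboundaries are those that extend to X_0. *)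
Lemma Ext_zeroS M (X : resolution M) n :
  projective_resolution X -> Ext_zero X N n.+1 <-> Ext_van N n M.
Proof.
elim: n M X => [|n IHn] M X hX; last first.
  have [Y [hY <-]] := syzygy_tail X.
  rewrite IHn; last by move=> k; rewrite hY; exact: hX.
  by rewrite (Ext_van_shift _ _ (ses_kermod (@res_aug_surj _ _ X)) (hX 0)).
have hs := ses_kermod (@res_aug_surj _ _ X).
have [|e eP] := kermod_lift (f := res_aug X) (h := res_diff X 0).
  by move=> y; apply/res_exact0; exists y.
have e_surj : surj e.
  move=> k; have /res_exact0[y yk] := kermodP k.
  by exists y; apply: val_inj; rewrite eP.
split=> [h|h f cf].
  apply: Ext_van_coker0 hs _ (Ext_van_projective N 0 (hX 0)) => f.
  have cf : cocycle (f \o e).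
    move=> y /=; rewrite (_ : e _ = 0) ?linear0 //.
    by apply: val_inj; rewrite eP res_diffK linear0.
  have [g gP] := h _ cf; exists g => k; have [y <-] := e_surj k.
  exact: etrans (congr1 g (eP y)) (esym (gP y)).
have [|f' f'P] := ses_desc (f := f) (ses_kermod e_surj).
  move=> k; have /(congr1 val) := kermodP k.
  rewrite eP => /(@res_exact _ _ X 0)[y yk].
  exact: etrans (congr1 f (esym yk)) (cf y).
have [g gP] := h _ _ _ _ hs f'.
exists g => x; exact: etrans (esym (f'P x)) (etrans (esym (gP (e x))) (congr1 g (eP x))).
Qed.

Lemma Ext_nonzero0 M :
  nonzero_module (Ext M N 0) <-> ~ forall (f : {linear M -> N}) x, f x = 0.
Proof. by rewrite -(Ext_zero_Hom (chosen_resolution M)) -hom_cohomology_nonzero. Qed.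

Lemma Ext_nonzeroS M n : nonzero_module (Ext M N n.+1) <-> ~ Ext_van N n M.
Proof.
by rewrite -(Ext_zeroS _ (@chosen_resolutionP _ M)) -hom_cohomology_nonzero.
Qed.

Lemma Ext_nonzeroE M (X : resolution M) n : projective_resolution X ->
  nonzero_module (Ext M N n) <-> ~ Ext_zero X N n.
Proof.
move=> hX; case: n => [|n]; first by rewrite Ext_nonzero0 (Ext_zero_Hom X).
by rewrite Ext_nonzeroS (Ext_zeroS _ hX).
Qed.

End ExtVanCochains.

(** * Noetherian modules *)

Section Span.
Variable R : comNzRingType.
Implicit Types U V W : lmodType R.

Fixpoint lspan V (s : seq V) (x : V) : Prop :=
  if s is g :: s' then exists a y, lspan s' y /\ x = a *: g + y else x = 0.

Lemma lspan_lin V (s : seq V) a x y : lspan s x -> lspan s y -> lspan s (a *: x + y).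
Proof.
elim: s x y => [|g s IHs] x y /= => [-> ->|]; first by rewrite scaler0 addr0.
move=> [b [u [hu ->]]] [c [v [hv ->]]].
exists (a * b + c), (a *: u + v); split; first exact: IHs.
by rewrite scalerDr scalerDl scalerA addrACA.
Qed.

Lemma lspan0 V (s : seq V) : lspan s 0.
Proof.
elim: s => [|g s IHs] //=; exists 0, 0; split=> //.
by rewrite scale0r addr0.
Qed.

Lemma lspan_mem V (s : seq V) x : x \in s -> lspan s x.
Proof.
elim: s => [|g s IHs] //=; rewrite inE => /orP[/eqP->|/IHs hx].
  by exists 1, 0; split; [exact: lspan0|rewrite scale1r addr0].
by exists 0, x; rewrite scale0r add0r.
Qed.

Lemma lspan_sub V (s : seq V) (S : submodule V) x :
  (forall g, g \in s -> S g) -> lspan s x -> S x.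
Proof.
elim: s x => [|g s IHs] x hS /= => [->|[a [y [hy ->]]]]; first exact: submod0.
apply: submodP; first by apply: hS; rewrite mem_head.
by apply: IHs hy => h hh; apply: hS; rewrite inE hh orbT.
Qed.

Definition lspan_submod V (s : seq V) : submodule V :=
  Submodule (lspan0 s) (@lspan_lin V s).

Lemma lspan_mono V (s t : seq V) x : {subset s <= t} -> lspan s x -> lspan t x.
Proof. by move=> st; apply: (@lspan_sub V s (lspan_submod t)) => g /st; exact: lspan_mem. Qed.

Lemma lspan_sum V (I : Type) (r : seq I) (c : I -> R) (g : I -> V) :
  lspan (map g r) (\sum_(i <- r) c i *: g i).
Proof.
elim: r => [|i r IHr] /=; first by rewrite big_nil.
by rewrite big_cons; exists (c i), (\sum_(j <- r) c j *: g j).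
Qed.

Lemma lspan_map U V (f : {linear U -> V}) s x : lspan s x -> lspan (map f s) (f x).
Proof.
elim: s x => [|g s IHs] x /= => [->|[a [y [hy ->]]]]; first exact: linear0.
by exists a, (f y); rewrite linearP; split=> //; exact: IHs.
Qed.

Lemma lspan_mapP U V (f : {linear U -> V}) s y :
  lspan (map f s) y -> exists2 x, lspan s x & f x = y.
Proof.
elim: s y => [|g s IHs] y /= => [->|[a [z [/IHs[x hx <-] ->]]]].
  by exists 0; rewrite ?linear0.
by exists (a *: g + x); [exists a, x|rewrite linearP].
Qed.

Lemma fg_lspan V : finitely_generated V <-> exists s : seq V, forall x, lspan s x.
Proof.
split=> [[n [g gP]]|[s sP]].
  by exists (map g (enum 'I_n)) => x; have [c ->] := gP x; rewrite -big_enum; exact: lspan_sum.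
exists (size s), (fun i => s`_i) => x.
suff [c ->] : exists c : nat -> R, x = \sum_(i < size s) c i *: s`_i by exists (fun i => c i).
have := sP x; elim: s x {sP} => [|g s IHs] x /= => [->|[a [y [/IHs[c ->] ->]]]].
  by exists (fun=> 0); rewrite big_ord0.
by exists (fun k => if k is k'.+1 then c k' else a); rewrite big_ord_recl.
Qed.

Lemma fg_surj U V (f : {linear U -> V}) :
  surj f -> finitely_generated U -> finitely_generated V.
Proof.
move=> f_surj /fg_lspan[s sP]; apply/fg_lspan; exists (map f s) => y.
by have [x <-] := f_surj y; exact: lspan_map.
Qed.

Local Notation free n := {ffun 'I_n -> R^o}.

Definition free_basis n (i : 'I_n) : free n := [ffun j => (i == j)%:R].

Lemma free_sum n (x : free n) : x = \sum_i x i *: free_basis i.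
Proof.
apply/ffunP => j; rewrite sum_ffunE (bigD1 j) //= big1 => [|i ij]; rewrite !ffunE.
  by rewrite eqxx addr0 -[_ *: _]/(x j * 1) mulr1.
by rewrite (negPf ij) scaler0.
Qed.

Lemma fg_free n : finitely_generated (free n).
Proof. by exists n, (@free_basis n) => x; exists x; exact: free_sum. Qed.

Lemma free_hom n V (u : 'I_n -> V) :
  exists h : {linear free n -> V}, forall x, h x = \sum_i x i *: u i.
Proof.
apply: (@lin_of_rel _ (free n) V (fun x v => v = \sum_i x i *: u i)) => [x|a x x' v v' -> ->|v ->].
- by eexists.
- rewrite scaler_sumr -big_split; apply: eq_bigr => i _ /=.
  by rewrite !ffunE scalerDl scalerA.
- by rewrite big1 // => i _; rewrite ffunE scale0r.
Qed.

Lemma free_coord n (i : 'I_n) : exists p : {linear free n -> R^o}, forall x, p x = x i.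
Proof.
apply: (@lin_of_rel _ (free n) R^o (fun x y => y = x i)) => [x|a x x' y y' -> ->|y ->].
- by eexists.
- by rewrite !ffunE.
- by rewrite ffunE.
Qed.

Lemma projective_free n : projective (free n).
Proof.
move=> U V g f g_surj.
have [u uP] := choice (fun i => g_surj (f (@free_basis n i))).
have [h hP] := free_hom u; exists h => x.
rewrite hP [in RHS](free_sum x) !linear_sum; apply: eq_bigr => i _.
by rewrite !linearZ /= uP.
Qed.

Lemma fg_cover V : finitely_generated V ->
  exists n (f : {linear free n -> V}), surj f.
Proof.
move=> [n [g gP]]; have [f fP] := free_hom g; exists n, f => x.
by have [c ->] := gP x; exists [ffun i => c i]; rewrite fP; apply: eq_bigr => i _; rewrite ffunE.
Qed.

End Span.

Section Noetherian.
Variables (R : comNzRingType) (R_noeth : noetherian R).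
Implicit Types U V L M : lmodType R.
Local Notation free n := {ffun 'I_n -> R^o}.

(** Leading coefficients, as in Hilbert's basis theorem: the coefficients of [g] in elements of [S]
    form an ideal [I]; lifts [w] of its generators, together with generators of the part of [S]
    inside [lspan s], generate [S]. *)
Lemma noetherian_lspan V (s : seq V) (S : submodule V) :
  (forall x, S x -> lspan s x) ->
  exists2 t : seq V, (forall g, g \in t -> S g) & forall x, S x -> lspan t x.
Proof.
elim: s S => [|g s IHs] S hS; first by exists [::].
pose I := [set a : R | exists2 y, lspan s y & S (a *: g + y)]%classic.
have I_ideal : ideal I.
  split; first by exists 0; [exact: lspan0|rewrite scale0r addr0; exact: submod0].
  move=> a b b' [y hy hb] [y' hy' hb']; exists (a *: y + y'); first exact: lspan_lin.
  by rewrite scalerDl -scalerA addrACA -scalerDr; exact: submodP.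
have [n [e eE]] := R_noeth I_ideal.
have /choice[y yP] i : exists y, lspan s y /\ S (e i *: g + y).
  suff [y hy1 hy2] : I (e i) by exists y.
  rewrite eE; exists (fun j => (i == j)%:R).
  rewrite (bigD1 i) //= big1 ?addr0 ?eqxx ?mul1r // => j ji.
  by rewrite eq_sym (negPf ji) mul0r.
pose w i := e i *: g + y i.
have hS0 : S 0 /\ lspan s 0 by split; [exact: submod0|exact: lspan0].
have hSP a x z : S x /\ lspan s x -> S z /\ lspan s z -> S (a *: x + z) /\ lspan s (a *: x + z).
  by move=> [? ?] [? ?]; split; [exact: submodP|exact: lspan_lin].
have [|t tS tP] := IHs (Submodule hS0 hSP); first by move=> x [].
exists (map w (enum 'I_n) ++ t) => [h|x Sx].
  by rewrite mem_cat => /orP[/mapP[i _ ->]|/tS[]//]; have [] := yP i.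
have [a [z [hz xE]]] := hS x Sx.
have : I a by exists z => //; rewrite -xE.
rewrite eE => -[c aE].
pose z' := \sum_(i <- enum 'I_n) c i *: w i.
have Sz' : S z'.
  rewrite /z'; elim: (enum _) => [|i r IHr]; first by rewrite big_nil; exact: submod0.
  by rewrite big_cons; apply: submodP IHr; have [] := yP i.
have z'E : z' = a *: g + \sum_(i <- enum 'I_n) c i *: y i.
  rewrite /z' aE -big_enum scaler_suml -big_split; apply: eq_bigr => i _ /=.
  by rewrite scalerDr scalerA.
have hsum : lspan s (\sum_(i <- enum 'I_n) c i *: y i).
  elim: (enum _) => [|i r IHr]; first by rewrite big_nil; exact: lspan0.
  by rewrite big_cons; apply: lspan_lin IHr; have [] := yP i.
have ht : lspan t (- 1 *: z' + x).
  apply: tP; split; first exact: submodP.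
  rewrite z'E xE scaleN1r opprD addrACA addNr add0r -scaleN1r.
  exact: lspan_lin.
have -> : x = 1 *: z' + (- 1 *: z' + x) by rewrite scale1r scaleN1r addrA subrr add0r.
apply: lspan_lin.
  by apply: (lspan_mono (s := map w (enum 'I_n))) (lspan_sum _ _ _) => h; rewrite mem_cat => ->.
by apply: lspan_mono ht => h; rewrite mem_cat orbC => ->.
Qed.

Lemma fg_submod V (S : submodule V) : finitely_generated V ->
  exists2 t : seq V, (forall g, g \in t -> S g) & forall x, S x -> lspan t x.
Proof. by move=> /fg_lspan[s sP]; apply: (noetherian_lspan (s := s)). Qed.

Lemma fg_inj U V (f : {linear U -> V}) :
  injective f -> finitely_generated V -> finitely_generated U.
Proof.
move=> f_inj V_fg; apply/fg_lspan.
have im0 : exists x, f x = 0 by exists 0; exact: linear0.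
have imP a y z : (exists x, f x = y) -> (exists x, f x = z) -> exists x, f x = a *: y + z.
  by move=> [u <-] [v <-]; exists (a *: u + v); rewrite linearP.
have [t tS tP] := fg_submod (Submodule im0 imP) V_fg.
have [t0 t0E] : exists t0, t = map f t0.
  elim: t {tP} tS => [|g t IHt] tS; first by exists [::].
  have [|t0 ->] := IHt; first by move=> h ht; apply: tS; rewrite inE ht orbT.
  have [x <-] := tS _ (mem_head _ _).
  by exists (x :: t0).
exists t0 => x; have /tP : exists x', f x' = f x by exists x.
by rewrite t0E => /lspan_mapP[x' hx' /f_inj <-].
Qed.

Lemma fg_dual M : finitely_generated M -> finitely_generated (dual M).
Proof.
move=> /fg_cover[n [f f_surj]].
have [e eP] : exists e : {linear dual M -> free n}, forall h,
    e h = [ffun i => h (f (free_basis R i))].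
  apply: (@lin_of_rel _ (dual M) (free n) (fun h x => x = [ffun i => h (f (free_basis R i))])).
  - by eexists.
  - by move=> a h h' x x' -> ->; apply/ffunP => i; rewrite !ffunE.
  - by move=> x ->; apply/ffunP => i; rewrite !ffunE.
apply: (fg_inj (f := e)) (fg_free R n).
apply: inj_of_ker => h; rewrite eP => /ffunP eh; apply: hom_ext => x.
have [y <-] := f_surj x; rewrite -[RHS]/(0 : R^o) (free_sum y) !linear_sum big1 // => i _.
by have := eh i; rewrite !ffunE !linearZ /= => ->; rewrite scaler0.
Qed.

(** Without a maximal member, choice yields a strictly increasing chain; its union is finitely
    generated, hence equal to one of its terms. *)
Lemma noetherian_max V (F : submodule V -> Prop) : finitely_generated V ->
  (exists S, F S) ->
  exists2 S, F S & forall S', F S' -> (forall x, S x -> S' x) -> forall x, S' x -> S x.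
Proof.
move=> V_fg [S0 FS0]; apply: contrapT => nomax.
have next (S : {S | F S}) : exists T : {S | F S},
    (forall x, sval S x -> sval T x) /\ exists2 x, sval T x & ~ sval S x.
  apply: contrapT => h; apply: nomax; exists (sval S); first exact: (svalP S).
  move=> S' FS' SS' x S'x; apply: contrapT => Sx; apply: h.
  by exists (exist _ S' FS'); split=> //; exists x.
have [T TP] := choice next.
pose W n := sval (iter n T (exist _ S0 FS0)).
have Wmono n k x : W n x -> W (n + k)%N x.
  by elim: k => [|k IHk]; rewrite ?addn0 // addnS => /IHk; exact: (TP _).1.
have u0 : exists n, W n 0 by exists 0%N; exact: submod0.
have uP a x y : (exists n, W n x) -> (exists n, W n y) -> exists n, W n (a *: x + y).
  move=> [n Wx] [k Wy]; exists (n + k)%N; apply: submodP; first exact: Wmono.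
  by rewrite addnC; exact: Wmono.
have [t tS tP] := fg_submod (Submodule u0 uP) V_fg.
have [n nP] : exists n, forall g, g \in t -> W n g.
  elim: t {tP} tS => [|g t IHt] tS; first by exists 0%N.
  have [|n nP] := IHt; first by move=> h ht; apply: tS; rewrite inE ht orbT.
  have [k Wg] := tS _ (mem_head _ _).
  exists (k + n)%N => h; rewrite inE => /orP[/eqP->|/nP]; first exact: Wmono.
  by rewrite addnC; exact: Wmono.
have [_ [x Wx]] := TP (iter n T (exist _ S0 FS0)); apply.
by apply: (lspan_sub nP); apply: tP; exists n.+1.
Qed.

Lemma fg_regular : finitely_generated (R^o : lmodType R).
Proof.
apply/fg_lspan; exists [:: 1] => x; exists x, 0; split=> //.
by rewrite addr0 -[RHS]/(x * 1) mulr1.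
Qed.

(** Bundled so that taking syzygies is an endofunction that [iter] can repeat. *)
Record fgmod := Fgmod { fgcar :> lmodType R; fgmodP : finitely_generated fgcar }.

Lemma fg_free_resolution M : finitely_generated M ->
  exists X : resolution M,
    projective_resolution X /\ forall n, finitely_generated (X n).
Proof.
move=> M_fg.
pose rk (L : fgmod) := projT1 (cid (fg_cover (fgmodP L))).
pose cov (L : fgmod) : {linear free (rk L) -> L} :=
  projT1 (cid (projT2 (cid (fg_cover (fgmodP L))))).
have cov_surj (L : fgmod) : surj (cov L) := projT2 (cid (projT2 (cid (fg_cover (fgmodP L))))).
have ker_fg (L : fgmod) : finitely_generated (kermod (cov L)).
  by apply: (fg_inj (f := val)) (fg_free R (rk L)) => x y; exact: val_inj.
pose syz n := iter n (fun L : fgmod => Fgmod (ker_fg L)) (Fgmod M_fg).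
pose d n : {linear free (rk (syz n.+1)) -> free (rk (syz n))} :=
  (val : {linear kermod (cov (syz n)) -> free (rk (syz n))}) \o cov (syz n.+1).
have ex0 n x : cov (syz n) x = 0 <-> exists y, d n y = x.
  split=> [/kermod_ex[k <-]|[y <-]]; last exact: kermodP (cov (syz n.+1) y).
  by have [y yk] := @cov_surj (syz n.+1) k; exists y; rewrite /d /= yk.
have ex n x : d n x = 0 <-> exists y, d n.+1 y = x.
  rewrite -(ex0 n.+1); split=> [h|h]; last by rewrite /d /= h.
  by apply: val_inj; exact: h.
exists (@Resolution R M (fun n => free (rk (syz n))) d (cov (syz 0)) (cov_surj (syz 0)) (ex0 0) ex); split=> n; first exact: projective_free.
exact: fg_free.
Qed.

End Noetherian.

(** * The residue field of a local ring *)

Section LocalRing.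
Variables (R : comNzRingType) (m : set R).
Hypotheses (R_noeth : noetherian R) (R_local : local_ring m).
Implicit Types A B C L M N U V W : lmodType R.

Lemma mfrak0 : m 0.
Proof. by case: R_local => -[[]]. Qed.

Lemma mfrak_lin a x y : m x -> m y -> m (a * x + y).
Proof. by case: R_local => -[[_ h] _ _] _; exact: h. Qed.

Lemma mfrakM a x : m x -> m (a * x).
Proof. by move=> mx; rewrite -[a * x]addr0; apply: mfrak_lin => //; exact: mfrak0. Qed.

Lemma mfrakD x y : m x -> m y -> m (x + y).
Proof. by move=> mx my; rewrite -[x]mul1r; exact: mfrak_lin. Qed.

Lemma mfrak1 : ~ m 1.
Proof. by case: R_local => -[]. Qed.

(** If [x] were not a unit, a largest proper ideal containing it would be maximal, hence equal to
    [m] by locality. *)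
Lemma unit_of_notin_mfrak x : ~ m x -> exists y, y * x = 1.
Proof.
move=> mx; apply: contrapT => x_nu.
pose F (S : submodule (R^o : lmodType R)) := ~ S 1 /\ S x.
have x0 : exists a, 0 = a * x by exists 0; rewrite mul0r.
have xP (a : R) (y z : R^o) : (exists b, y = b * x) -> (exists b, z = b * x) ->
    exists b, a *: y + z = b * x.
  move=> [b ->] [c ->]; exists (a * b + c).
  by rewrite mulrDl -mulrA.
have [||S [S1 Sx] Smax] := @noetherian_max _ R_noeth R^o F.
- exact: fg_regular.
- exists (Submodule x0 xP); split; last by exists 1; rewrite mul1r.
  by move=> [b hb]; apply: x_nu; exists b.
apply: mx; rewrite -(R_local.2 (S : set R)) //; split=> //.
  by split; [exact: submod0|move=> a y z; exact: submodP].
move=> I [I0 IP] I1 SI; apply/seteqP; split=> // y Iy.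
have FI : F (@Submodule R R^o I I0 IP) by split=> //; exact: SI.
exact: (Smax _ FI SI y Iy).
Qed.

Definition mfrak_submod : submodule (R^o : lmodType R) :=
  @Submodule R R^o m mfrak0 mfrak_lin.

Definition residue : lmodType R := quotmod mfrak_submod.

Definition res_pi : {linear R^o -> residue} := quot_pi mfrak_submod.

Lemma res_pi_surj : surj res_pi.
Proof. exact: quot_pi_surj. Qed.

Lemma res_pi_eq0 x : res_pi x = 0 <-> m x.
Proof. exact: (quot_pi_eq0 mfrak_submod). Qed.

Lemma res_piM a b : res_pi (a * b) = a *: res_pi b.
Proof. exact: (linearZ_LR res_pi a b). Qed.

Lemma residue_ann r (v : residue) : m r -> r *: v = 0.
Proof.
by move=> mr; have [a <-] := res_pi_surj v; rewrite -res_piM mulrC; exact/res_pi_eq0/mfrakM.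
Qed.

(** Nakayama's lemma in the form used throughout. Redundant generators are dropped until [g] lies
    outside the span of the rest; its coefficient is then well defined modulo [m], since a relation
    with a unit coefficient would put [g] into that span. *)
Lemma residue_map L : finitely_generated L -> nonzero_module L ->
  exists (c : {linear L -> residue}) (x : L), c x = res_pi 1.
Proof.
move=> /fg_lspan[s]; elim: s => [|g s IHs] sP [x0 x0n0].
  by move/eqP: x0n0; case; exact: sP.
have [sg|sg] := pselect (lspan s g).
  apply: IHs; last by exists x0.
  move=> x; have [a [y [hy ->]]] := sP x; exact: lspan_lin.
have [|||c cP] := @lin_of_rel _ L residue
    (fun x v => exists a y, [/\ lspan s y, x = a *: g + y & v = res_pi a]).
- by move=> x; have [a [y [hy ->]]] := sP x; exists (res_pi a), a, y.
- move=> b x x' v v' [a [y [hy -> ->]]] [a' [y' [hy' -> ->]]].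
  exists (b * a + a'), (b *: y + y'); split; first exact: lspan_lin.
    by rewrite scalerDl -scalerA addrACA -scalerDr.
  exact: esym (linearP res_pi b a a').
- move=> v [a [y [hy gy ->]]]; apply/res_pi_eq0.
  apply: contrapT => /unit_of_notin_mfrak[b ba]; apply: sg.
  have -> : g = (- b) *: y + 0.
    move/eqP: gy; rewrite eq_sym addr_eq0 => /eqP ag.
    by rewrite addr0 scaleNr -scalerN -ag scalerA ba scale1r.
  exact: lspan_lin (lspan0 _).
exists c, g; have [a [y [hy gE ->]]] := cP g.
apply/eqP; rewrite -subr_eq0 -linearB; apply/eqP/res_pi_eq0.
apply: contrapT => /unit_of_notin_mfrak[b ba]; apply: sg.
have -> : g = (- b) *: y + 0.
  have ag : (a - 1) *: g = - y.
    by rewrite scalerBl scale1r [X in _ - X]gE opprD addrA subrr add0r.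
  by rewrite addr0 scaleNr -scalerN -ag scalerA ba scale1r.
exact: lspan_lin (lspan0 _).
Qed.

Lemma res_pi1_neq0 : res_pi 1 <> 0.
Proof. by move/res_pi_eq0; exact: mfrak1. Qed.

(* Zero divisors are avoided by building up x in m outside more and more
   annihilators P_i = ann(y_i) that are maximal among annihilators: the chain of
   submodules spanned by the y_i is stationary, which the primality of P_(n+1)
   excludes. *)
Section PrimeAvoidance.
Variable M : lmodType R.
Hypothesis M_fg : finitely_generated M.

Definition max_ann (y : M) : Prop :=
  y != 0 /\ forall z : M, z != 0 -> (forall a, a *: y = 0 -> a *: z = 0) ->
    forall a, a *: z = 0 -> a *: y = 0.

Lemma max_ann_exists a (z : M) : z != 0 -> a *: z = 0 ->
  exists2 y, max_ann y & a *: y = 0.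
Proof.
move=> z0 az.
have ann0 (y : M) : (0 : R) *: y = 0 by exact: scale0r.
have annP (y : M) (b : R) (u v : R^o) : (u : R) *: y = 0 -> (v : R) *: y = 0 ->
    ((b *: u + v : R^o) : R) *: y = 0.
  by move=> uy vy; rewrite scalerDl -scalerA uy vy scaler0 addr0.
pose ann y : submodule (R^o : lmodType R) := @Submodule R R^o (fun a => (a : R) *: y = 0) (ann0 y) (@annP y).
pose F S := exists2 y : M, y != 0 & S = ann y /\ a *: y = 0.
have [||S [y y0 [SE ay]] Smax] := @noetherian_max _ R_noeth R^o F.
- exact: fg_regular.
- by exists (ann z); exists z; [|split].
exists y => //; split=> // w w0 yw b bw.
rewrite SE in Smax; apply: (Smax (ann w) _ yw b bw).
by exists w => //; split=> //; exact: yw.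
Qed.

Lemma max_ann_prime y a b : max_ann y -> (a * b) *: y = 0 -> a *: y = 0 \/ b *: y = 0.
Proof.
move=> [y0 ymax] aby; have [->|by0] := eqVneq (b *: y) 0; [by right|left].
apply: (ymax (b *: y)) => //; last by rewrite scalerA.
by move=> c cy; rewrite scalerA mulrC -scalerA cy scaler0.
Qed.

Lemma socle_of_no_regular :
  (forall x, m x -> exists2 y : M, y != 0 & x *: y = 0) ->
  exists2 y : M, y != 0 & forall x, m x -> x *: y = 0.
Proof.
move=> zd; apply: contrapT => nosoc.
have notm y : max_ann y -> exists2 r, m r & r *: y != 0.
  move=> [y0 _]; apply: contrapT => h; apply: nosoc; exists y => // x mx.
  by apply/eqP/negPn/negP => xy; apply: h; exists x.
pose F (S : submodule M) := exists s : seq M,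
  [/\ forall y, y \in s -> max_ann y, S = lspan_submod s &
      exists2 x, m x & forall y, y \in s -> x *: y != 0].
have [||S [s [s_max SE [x mx xs]]] Smax] := @noetherian_max _ R_noeth M F.
- exact: M_fg.
- by exists (lspan_submod [::]), [::]; split=> //; exists 0 => //; exact: mfrak0.
have [z z0 xz] := zd x mx; have [y y_max xy] := max_ann_exists z0 xz.
(* [b] is a product of an element of [m] outside ann(y) and, for each [w] in [s], one of ann(w)
   outside ann(y); primality keeps the product outside ann(y). *)
have [b [mb bs by0]] : exists b, [/\ m b, forall z, z \in s -> b *: z = 0 & b *: y != 0].
  elim: s s_max xs {SE Smax} => [|w s IHs] s_max xs.
    by have [r mr ry] := notm y y_max; exists r.
  have [||b [mb bs by0]] := IHs.
  - by move=> v vs; apply: s_max; rewrite inE vs orbT.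
  - by move=> v vs; apply: xs; rewrite inE vs orbT.
  (* Otherwise ann(w) lies in ann(y), maximality makes them equal, and [x] would kill [w]. *)
  have [c cw cy] : exists2 c, c *: w = 0 & c *: y != 0.
    apply: contrapT => h; have [_ wmax] := s_max _ (mem_head _ _).
    have := xs _ (mem_head _ _); rewrite (wmax y _ _ x xy) ?eqxx ?y_max.1 //.
    by move=> a aw; apply/eqP/negPn/negP => ay; apply: h; exists a.
  exists (c * b); split; first exact: mfrakM.
    move=> v; rewrite inE => /orP[/eqP->|/bs bv]; last by rewrite -scalerA bv scaler0.
    by rewrite mulrC -scalerA cw scaler0.
  by apply/eqP => /(max_ann_prime y_max)[]; apply/eqP.
(* [x + b] kills neither [y] nor any member of [s], so maximality puts [y] into the span of [s],
   which [b] kills. *)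
have Fy : F (lspan_submod (y :: s)).
  exists (y :: s); split=> //.
    by move=> v; rewrite inE => /orP[/eqP->|/s_max].
  exists (x + b); first exact: mfrakD.
  move=> v; rewrite inE scalerDl => /orP[/eqP->|vs]; first by rewrite xy add0r.
  by rewrite bs // addr0 xs.
have sy : lspan s y.
  have := Smax _ Fy; rewrite SE; apply; last by apply: lspan_mem; exact: mem_head.
  by move=> v; apply: lspan_mono => u; rewrite inE => ->; rewrite orbT.
have b0 : b *: (0 : M) = 0 by exact: scaler0.
have bP a (u v : M) : b *: u = 0 -> b *: v = 0 -> b *: (a *: u + v) = 0.
  by move=> bu bv; rewrite scalerDr scalerA mulrC -scalerA bu bv scaler0 addr0.
by move/eqP: by0; apply; exact: (@lspan_sub _ _ s (Submodule b0 bP) y bs sy).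
Qed.

End PrimeAvoidance.

(** * Ext out of the residue field *)

Section ResidueExt.
Variable X : resolution residue.
Hypothesis X_proj : projective_resolution X.

Lemma residue_homotopy0 r : m r ->
  exists s : {linear X 0%N -> X 1%N}, forall x, r *: x = res_diff X 0 (s x).
Proof.
move=> mr.
have [|e eP] := kermod_lift (f := res_aug X) (h := res_diff X 0).
  by move=> y; apply/res_exact0; exists y.
have e_surj : surj e.
  move=> k; have /res_exact0[y yk] := kermodP k.
  by exists y; apply: val_inj; rewrite eP.
have [|u uP] := kermod_lift (f := res_aug X) (h := r \*: idfun).
  by move=> w /=; rewrite linearZ /= residue_ann.
have [s sP] := X_proj u e_surj.
by exists s => x; rewrite -eP sP uP.
Qed.

(* Multiplication by r in m is null-homotopic on a resolution of R/m. *)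
Lemma residue_homotopy r n : m r ->
  exists (s : {linear X n -> X n.+1}) (t : {linear X n.+1 -> X n.+2}),
    forall x, r *: x = res_diff X n.+1 (t x) + s (res_diff X n x).
Proof.
move=> mr.
have factor (j : nat) (u : {linear X j.+1 -> X j.+1}) :
    (forall x, res_diff X j (u x) = 0) ->
    exists t : {linear X j.+1 -> X j.+2}, forall x, res_diff X j.+1 (t x) = u x.
  move=> du.
  have [u' u'P] := kermod_lift du.
  have [|e eP] := kermod_lift (f := res_diff X j) (h := res_diff X j.+1).
    by move=> y; exact: res_diffK.
  have e_surj : surj e.
    move=> k; have /res_exact[y yk] := kermodP k.
    by exists y; apply: val_inj; rewrite eP.
  have [t tP] := X_proj u' e_surj.
  by exists t => x; rewrite -eP tP u'P.
pose mul (j : nat) : {linear X j -> X j} := r \*: idfun.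
elim: n => [|n [s [t stP]]].
  have [s sE] := residue_homotopy0 mr.
  have [|t tP] := factor 0%N (mul 1%N \- (s \o res_diff X 0)).
    by move=> x /=; rewrite linearB /= -sE linearZ subrr.
  by exists s, t => x; rewrite tP /= subrK.
exists t; have [|t' t'P] := factor n.+1 (mul n.+2 \- (t \o res_diff X n.+1)).
  move=> x /=; rewrite linearB linearZ /= [X in X - _]stP res_diffK linear0 addr0.
  by rewrite subrr.
by exists t' => x; rewrite t'P /= subrK.
Qed.

Lemma residue_Ext_ann r N i (f g : {linear X i -> N}) :
  m r -> cocycle f -> (forall x, g x = r *: f x) -> coboundary g.
Proof.
move=> mr cf gE; case: i f g cf gE => [|i] f g cf gE /=.
  by move=> x; have [s sP] := residue_homotopy0 mr; rewrite gE -linearZ sP cf.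
have [s [t stP]] := residue_homotopy i mr.
by exists (f \o s) => x /=; rewrite gE -linearZ stP linearD cf add0r.
Qed.

Definition Ext_depth N (e : nat) : Prop :=
  (forall i, (i < e)%N -> Ext_zero X N i) /\ ~ Ext_zero X N e.

(** If all elements of [m] were zero divisors on [N], a socle element [y] would give a nonzero map
    R/m -> N, 1 |-> y. *)
Lemma regular_of_Ext_zero N : finitely_generated N -> Ext_zero X N 0 ->
  exists2 x, m x & injective (fun y : N => x *: y).
Proof.
move=> N_fg /Ext_zero_Hom hN; apply: contrapT => noreg.
have [x mx|y y0 ymy] := socle_of_no_regular N_fg.
  apply: contrapT => h; apply: noreg; exists x => // u v /= uv.
  apply/eqP; rewrite -subr_eq0; apply/negPn/negP => uv0; apply: h; exists (u - v) => //.
  by rewrite scalerBr uv subrr.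
have [|||f fP] := @lin_of_rel _ residue N (fun v z => exists2 a : R, v = res_pi a & z = a *: y).
- by move=> v; have [a <-] := res_pi_surj v; exists (a *: y), a.
- move=> a u u' v v' [b -> ->] [c -> ->]; exists (a * b + c).
    exact: esym (linearP res_pi a b c).
  by rewrite scalerDl scalerA.
- by move=> v [a /esym/res_pi_eq0 ma ->]; exact: ymy.
(* [f] is known only through some representative [b] of 1; the difference lies in [m] and kills
   [y]. *)
have [b /eqP] := fP (res_pi 1).
rewrite eq_sym -subr_eq0 -linearB => /eqP/res_pi_eq0 mb fE.
move/eqP: y0; apply; rewrite -(hN f (res_pi 1)) fE -[LHS]scale1r.
by apply/eqP; rewrite -subr_eq0 -scalerBl -opprB scaleNr ymy ?oppr0.
Qed.

(** Long exact sequence of multiplication by [x]: since [x] lies in [m], it acts as zero on Ext out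
    of R/m, so wherever it acts injectively that Ext vanishes. *)
Lemma Ext_zero_regular_quotient A C x (q : {linear A -> C}) i :
  m x -> injective (fun y : A => x *: y) -> surj q ->
  (forall y, q y = 0 <-> exists z, x *: z = y) ->
  (Ext_zero X A i -> Ext_zero X A i.+1 -> Ext_zero X C i) /\
  ((forall j, i = j.+1 -> Ext_zero X C j) -> Ext_zero X A i).
Proof.
move=> mx x_inj q_surj qP.
have hs : ses (x \*: idfun : {linear A -> A}) q by split.
split=> [|hC f cf]; first exact: Ext_zero_coker hs.
by apply: (coboundary_pull X_proj hs hC); apply: (residue_Ext_ann mx cf) => y.
Qed.

End ResidueExt.

End LocalRing.

(** * Totally reflexive modules *)

Section TotallyReflexive.
Variables (R : comNzRingType) (R_noeth : noetherian R).
Implicit Types A B C G K L M N U V : lmodType R.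
Local Notation free n := {ffun 'I_n -> R^o}.
Local Notation Ext_vanR := (Ext_van R^o).

Lemma bijectiveP (U V : Type) (f : U -> V) :
  bijective f <-> injective f /\ forall y, exists x, f x = y.
Proof.
split=> [[g fK gK]|[f_inj /choice[g gK]]].
  by split; [exact: can_inj fK | move=> y; exists (g y)].
by exists g => // x; apply: f_inj; rewrite gK.
Qed.

Lemma reflexiveP M : reflexive_module M <->
  (forall x : M, (forall f : {linear M -> R^o}, f x = 0) -> x = 0) /\
  (forall F : {linear dual M -> R^o}, exists x : M, forall f : dual M, F f = f x).
Proof.
rewrite /reflexive_module bijectiveP; split=> -[hi hs]; split.
- move=> x fx; apply: hi; apply: hom_ext => f.
  by rewrite -[LHS]/(f x) -[RHS]/(f 0) fx linear0.
- by move=> F; have [x xF] := hs F; exists x => f; rewrite -xF.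
- move=> x y xy; apply/eqP; rewrite -subr_eq0; apply/eqP/hi => f.
  have /(congr1 (fun u : dual (dual M) => u f)) := xy.
  by rewrite -[LHS]/(f x) -[RHS]/(f y) linearB => ->; rewrite subrr.
- by move=> F; have [x xF] := hs F; exists x; apply: hom_ext => f; rewrite xF.
Qed.

Definition tot_refl M : Prop :=
  [/\ finitely_generated M, reflexive_module M &
      forall n, Ext_vanR n M /\ Ext_vanR n (dual M)].

Lemma totally_reflexiveP M : totally_reflexive M <-> tot_refl M.
Proof.
split=> -[fgM rM h]; split=> // n; last case: n => // n _.
  have [] := h n.+1 isT; rewrite !Ext_nonzeroS => h1 h2.
  by split; apply: contrapT.
by rewrite !Ext_nonzeroS; have [h1 h2] := h n; split=> -[].
Qed.

Lemma ses_dual A B C (i : {linear A -> B}) (p : {linear B -> C}) :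
  ses i p ->
  (forall f : {linear A -> R^o}, exists g : {linear B -> R^o}, forall x, g (i x) = f x) ->
  ses (precomp (N := R^o) p) (precomp (N := R^o) i).
Proof.
move=> hi hext; have [i_inj p_surj ip] := hi; split.
- move=> f g /(congr1 (fun u : dual B => u : B -> R^o)) fg; apply: hom_ext => z.
  by have [y <-] := p_surj z; exact: (congr1 (fun u => u y) fg).
- by move=> f; have [g gP] := hext f; exists (g : linhom _ _); apply: hom_ext.
- move=> f; split=> [fi|[g <-]].
    have [|g gP] := ses_desc (f := f) hi.
      by move=> x; exact: (congr1 (fun u : dual A => u x) fi).
    by exists (g : linhom _ _); apply: hom_ext.
  by apply: hom_ext => x; rewrite /= (ses_comp0 x hi) linear0.
Qed.

(** Ext^1(C, R) = 0 keeps the dual sequence exact and Ext^1(A^*, R) = 0 keeps the bidual one exact,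
    so biduality of [C] inherits bijectivity from [A] and [B]. *)
Lemma tot_refl_coker A B C (i : {linear A -> B}) (p : {linear B -> C}) :
  ses i p -> tot_refl A -> tot_refl B -> Ext_vanR 0 C -> tot_refl C.
Proof.
move=> hi [fgA rA hA] [fgB rB hB] hC; have [i_inj p_surj ip] := hi.
have hd := ses_dual hi (fun f => hC _ _ _ _ hi f); have [_ res_surj _] := hd.
split.
- exact: fg_surj p_surj fgB.
- have [Binj Bsurj] := (reflexiveP B).1 rB.
  have [Ainj Asurj] := (reflexiveP A).1 rA.
  apply/reflexiveP; split=> [z zf|F].
    have [y yz] := p_surj z; rewrite -yz.
    have [|T TP] := ses_desc (f := (evalfun y : {linear dual B -> R^o})) hd.
      by move=> f; rewrite -[LHS]/(f (p y)) yz zf.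
    have [x xT] := Asurj T.
    rewrite (_ : y = i x) ?(ses_comp0 x hi) //.
    apply/eqP; rewrite -subr_eq0; apply/eqP/Binj => f.
    have := TP f; rewrite xT => xf.
    by apply/eqP; rewrite linearB subr_eq0; apply/eqP; exact: esym xf.
  have [H HP] := (hA 0%N).2 _ _ _ _ hd F.
  have [y yH] := Bsurj H; exists (p y) => f.
  by rewrite -HP yH.
- move=> n; split.
    case: n => [//|n].
    by apply: Ext_van_coker hi _ _; [exact: (hA n).1 | exact: (hB n.+1).1].
  by apply: Ext_van_ker hd _ _; [exact: (hB n).2 | exact: (hA n.+1).2].
Qed.

Lemma fg_zero M : (forall x : M, x = 0) -> finitely_generated M.
Proof. by move=> M0; apply/fg_lspan; exists [::] => x; exact: M0. Qed.

Lemma projective_zero M : (forall x : M, x = 0) -> projective M.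
Proof. by move=> M0 U V g f _; exists \0 => x; rewrite (M0 x) !linear0. Qed.

Lemma tot_refl_zero M : (forall x : M, x = 0) -> tot_refl M.
Proof.
move=> M0; have D0 (f : dual M) : f = 0 by apply: hom_ext => x; rewrite (M0 x) !linear0.
split; first exact: fg_zero.
  apply/reflexiveP; split=> // F; exists 0 => f.
  by rewrite (D0 f) linear0.
by move=> n; split; apply/Ext_van_projective/projective_zero.
Qed.

Lemma tot_refl_iso A B (f : {linear A -> B}) : bijective f -> tot_refl A -> tot_refl B.
Proof.
move=> f_bij hA; have [f_inj f_surj] := (bijectiveP f).1 f_bij.
apply: (tot_refl_coker (ses_kermod f_surj) _ hA _).
  apply: tot_refl_zero => x; apply: val_inj; apply: f_inj.
  by rewrite kermodP linear0.
by case: hA => _ _ /(_ 0%N)[h _]; exact: Ext_van_iso f_bij h.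
Qed.

Lemma projective_dual_free n : projective (dual (free n)).
Proof.
have [p pP] := choice (@free_coord R n).
have [r rP] := free_hom (p : 'I_n -> dual (free n)).
have [s sP] : exists s : {linear dual (free n) -> free n}, forall h,
    s h = [ffun i => h (free_basis R i)].
  apply: (@lin_of_rel _ (dual (free n)) (free n) (fun h x => x = [ffun i => h (free_basis R i)])).
  - by eexists.
  - by move=> a h h' x x' -> ->; apply/ffunP => i; rewrite !ffunE.
  - by move=> x ->; apply/ffunP => i; rewrite !ffunE.
apply: (projective_retract (r := r) (s := s)) (@projective_free R n) _ => h.
apply: hom_ext => x; rewrite [in RHS](free_sum x) linear_sum rP.
rewrite (_ : (\sum_i s h i *: (p i : dual (free n))) x = \sum_i s h i *: p i x); last first.
  by elim/big_rec2: _ => // i y z _ <-.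
apply: eq_bigr => i _; rewrite sP ffunE pP linearZ /=.
by rewrite -[_ *: _]/(_ * _) mulrC.
Qed.

Lemma tot_refl_free n : tot_refl (free n).
Proof.
have [p pP] := choice (@free_coord R n).
split; first exact: fg_free.
  apply/reflexiveP; split=> [x fx|F].
    by apply/ffunP => i; rewrite -pP fx ffunE.
  exists [ffun i => F (p i)] => f.
  rewrite (_ : f = \sum_i f (free_basis R i) *: (p i : dual (free n))); last first.
    apply: hom_ext => x; rewrite [in LHS](free_sum x) linear_sum.
    rewrite (_ : (\sum_i f (free_basis R i) *: (p i : dual (free n))) x =
        \sum_i f (free_basis R i) *: p i x); last first.
      by elim/big_rec2: _ => // i y z _ <-.
    by apply: eq_bigr => i _; rewrite pP linearZ /= -[_ *: _]/(_ * _) mulrC.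
  set y := [ffun i => _].
  rewrite linear_sum.
  rewrite (_ : (\sum_i f (free_basis R i) *: (p i : dual (free n))) y =
        \sum_i f (free_basis R i) *: p i y); last first.
    by elim/big_rec2: _ => // i u v _ <-.
  by apply: eq_bigr => i _; rewrite linearZ /= pP ffunE.
move=> k; split; apply: Ext_van_projective; first exact: projective_free.
exact: projective_dual_free.
Qed.

(** The coordinates of [a] are generators of G^*, so every functional on [G] extends to the free
    module; this is what makes Ext^1(C, R) vanish, and then [C] is totally reflexive. *)
Lemma tot_refl_embed G : tot_refl G ->
  exists n (a : {linear G -> free n}) C (b : {linear free n -> C}),
    [/\ ses a b, tot_refl C &
        forall f : {linear G -> R^o}, exists c : 'I_n -> R,
          forall x, f x = \sum_i c i * a x i].
Proof.
move=> hG; have [fgG rG EG] := hG; have [Ginj Gsurj] := (reflexiveP G).1 rG.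
have [n [g gP]] := fg_dual R_noeth fgG.
have [a aP] : exists a : {linear G -> free n}, forall x, a x = [ffun i => g i x].
  apply: (@lin_of_rel _ G (free n) (fun x y => y = [ffun i => g i x])) => [x|c x x' y y' -> ->|y ->].
  - by eexists.
  - by apply/ffunP => i; rewrite !ffunE linearP.
  - by apply/ffunP => i; rewrite !ffunE linear0.
have span_a (f : {linear G -> R^o}) : exists c : 'I_n -> R, forall x, f x = \sum_i c i * a x i.
  have [c fc] := gP f; exists c => x.
  have -> : f x = (\sum_i c i *: g i : dual G) x by rewrite -fc.
  transitivity (\sum_i c i *: g i x).
    by elim/big_rec2: _ => // i u v _ <-.
  by apply: eq_bigr => i _; rewrite aP ffunE.
have a_inj : injective a.
  apply: inj_of_ker => x ax; apply: Ginj => f; have [c ->] := span_a f.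
  by rewrite big1 // => i _; rewrite ax ffunE mulr0.
have S0 : exists x, a x = 0 by exists 0; exact: linear0.
have SP c y z : (exists x, a x = y) -> (exists x, a x = z) -> exists x, a x = c *: y + z.
  by move=> [u <-] [v <-]; exists (c *: u + v); rewrite linearP.
pose S := Submodule S0 SP.
have hs : ses a (quot_pi S).
  by split=> //; [exact: quot_pi_surj | move=> y; exact: (quot_pi_eq0 S)].
exists n, a, (quotmod S), (quot_pi S); split=> //.
apply: (tot_refl_coker hs hG (tot_refl_free n)).
apply: (Ext_van_coker0 hs _ (Ext_van_projective _ _ (@projective_free R n))) => f.
have [c fc] := span_a f; have [h hP] := free_hom (V := R^o) c.
exists h => x; rewrite hP fc; apply: eq_bigr => i _.
by rewrite -[_ *: _]/(_ * _) mulrC.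
Qed.

(** A [Gorenstein_resolution] of length [n] peeled off one syzygy at a time, for induction on
    [n]. *)
Fixpoint Gdim_le (n : nat) M : Prop :=
  if n is n'.+1 then
    exists K G (j : {linear K -> G}) (q : {linear G -> M}),
      [/\ ses j q, tot_refl G & Gdim_le n' K]
  else tot_refl M.

(* The obstruction to lowering n in Gdim_le n M. *)
Definition Gdim_sharp n M : Prop :=
  if n is k.+1 then ~ Ext_vanR k M else nonzero_module M.

Lemma Gdim_le_van n M i : Gdim_le n M -> (n <= i)%N -> Ext_vanR i M.
Proof.
elim: n M i => [|n IHn] M i; first by case=> _ _ /(_ i)[].
move=> [K [G [j [q [hj [_ _ hG] hK]]]]]; case: i => // i ni.
by apply: Ext_van_coker hj _ (hG i.+1).1; exact: IHn.
Qed.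

(** Hence a minimal bound is sharp in the sense of [Gdim_sharp]. The vanishing passes down the
    syzygies to the last step, where [tot_refl_coker] merges two terms. *)
Lemma Gdim_le_drop n M : Gdim_le n.+1 M -> Ext_vanR n M -> Gdim_le n M.
Proof.
elim: n M => [|n IHn] M [K [G [j [q [hj hG hK]]]]] hM.
  exact: tot_refl_coker hj hK hG hM.
exists K, G, j, q; split=> //; apply: IHn => //.
by case: hG => _ _ /(_ n)[hGn _]; exact: Ext_van_ker hj hGn hM.
Qed.

Lemma Gdim_leP n M :
  (exists X : resolution M, Gorenstein_resolution n X) <-> Gdim_le n M.
Proof.
elim: n M => [|n IHn] M; split.
- move=> [X [hle hgt]].
  have X1 (x : X 1%N) : x = 0 by exact: ((nonzeroPn _).1 (hgt 1%N isT)).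
  apply: (tot_refl_iso (f := res_aug X)); last first.
    by apply/totally_reflexiveP; exact: hle.
  apply/bijectiveP; split; last exact: res_aug_surj.
  by apply: inj_of_ker => x /res_exact0[y <-]; rewrite (X1 y) linear0.
- move=> hM; pose Z : lmodType R := kermod (idfun : {linear R^o -> R^o}).
  have Z0 (z : Z) : z = 0 by apply: val_inj; exact: (kermodP z).
  pose obj n : lmodType R := if n is _.+1 then Z else M.
  pose d n : {linear obj n.+1 -> obj n} := \0.
  have s0 : surj (idfun : {linear obj 0%N -> M}) by move=> x; exists x.
  have e0 x : (idfun : {linear obj 0%N -> M}) x = 0 <-> exists y, d 0%N y = x.
    by split=> [/= ->|[y <-]//]; exists 0.
  have e1 n x : d n x = 0 <-> exists y, d n.+1 y = x.
    by split=> // _; exists 0; rewrite [x]Z0.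
  exists (Resolution s0 e0 e1); split=> -[|i] //= _.
    by apply/totally_reflexiveP.
  by apply/nonzeroPn.
- move=> [X [hle hgt]].
  have [Y [hY _]] := syzygy_tail R^o X.
  exists (first_syzygy X), (X 0%N), val, (res_aug X); split.
  + exact/ses_kermod/res_aug_surj.
  + by apply/totally_reflexiveP; exact: hle.
  + apply/IHn; exists Y; split=> i hi; rewrite hY; first exact: hle.
    exact: hgt.
- move=> [K [G [j [q [hj hG /IHn[Y [hle hgt]]]]]]].
  have [j_inj q_surj jq] := hj.
  pose obj k : lmodType R := if k is k'.+1 then Y k' else G.
  pose d k : {linear obj k.+1 -> obj k} :=
    match k return {linear obj k.+1 -> obj k} with
    | 0 => j \o res_aug Y
    | k'.+1 => res_diff Y k' end.
  have e0 x : q x = 0 <-> exists y, d 0%N y = x.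
    rewrite jq; split=> [[k <-]|[y <-]]; last by exists (res_aug Y y).
    by have [y <-] := res_aug_surj Y k; exists y.
  have e1 i x : d i x = 0 <-> exists y, d i.+1 y = x.
    case: i x => [|k] x; last exact: res_exact.
    rewrite -[X in _ <-> X]res_exact0 /=; split=> [/(ker_of_inj j_inj)//|->].
    exact: linear0.
  exists (@Resolution R M obj d q q_surj e0 e1); split=> -[|i] //= hi; last 2 first.
  + exact: hle.
  + exact: hgt.
  by apply/totally_reflexiveP.
Qed.

End TotallyReflexive.

(** * Rees' theorem: depth through Ext out of the residue field *)

Section DepthExt.
Variables (R : comNzRingType) (m : set R).
Hypotheses (R_noeth : noetherian R) (R_local : local_ring m).
Implicit Types A B C G K L M N U V : lmodType R.
Local Notation free n := {ffun 'I_n -> R^o}.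
Variable X : resolution (residue R_local).
Hypothesis X_proj : projective_resolution X.

(** With S' = S + aM, the quotient M/S' is the cokernel of [a] on M/S. The elementwise description
    of [S'] fits both an ideal enlarged by one element and [ideal_mul] of a longer sequence. *)
Lemma quotmod_step M (S S' : submodule M) (a : R) :
  (forall y, S' y <-> exists u z, S u /\ y = u + a *: z) ->
  exists q : {linear quotmod S -> quotmod S'},
    surj q /\ forall y, q y = 0 <-> exists z, a *: z = y.
Proof.
move=> S'E.
have hS : ses (val : {linear kermod (quot_pi S) -> M}) (quot_pi S).
  exact/ses_kermod/quot_pi_surj.
have [|q qP] := ses_desc (f := quot_pi S') hS.
  move=> k; apply/quot_pi_eq0/S'E; exists (val k), 0.
  by rewrite scaler0 addr0; split=> //; apply/quot_pi_eq0; exact: kermodP.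
exists q; split=> [y|y].
  by have [x <-] := quot_pi_surj y; exists (quot_pi S x); rewrite qP.
have [x <-] := quot_pi_surj y; rewrite qP quot_pi_eq0 S'E; split.
  move=> [u [z [Su ->]]]; exists (quot_pi S z).
  rewrite -linearZ; apply/eqP; rewrite eq_sym -subr_eq0 -linearB addrK.
  exact/eqP/quot_pi_eq0.
move=> [z]; have [w <-] := quot_pi_surj z => /eqP.
rewrite eq_sym -linearZ -subr_eq0 -linearB => /eqP/quot_pi_eq0 h.
by exists (x - a *: w), w; split=> //; rewrite subrK.
Qed.

Lemma quotmod0_iso M (S : submodule M) : (forall x, S x -> x = 0) ->
  exists (r : {linear quotmod S -> M}) (s : {linear M -> quotmod S}),
    (forall x, r (s x) = x) /\ (forall x, s (r x) = x).
Proof.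
move=> S0.
have hS : ses (val : {linear kermod (quot_pi S) -> M}) (quot_pi S).
  exact/ses_kermod/quot_pi_surj.
have [|r rP] := ses_desc (f := idfun) hS.
  by move=> k /=; apply: S0; apply/quot_pi_eq0; exact: kermodP.
exists r, (quot_pi S); split=> // y; have [x <-] := quot_pi_surj y.
by rewrite rP.
Qed.

(** Finiteness of depth without dimension theory: if every Ext^i(R/m, R) vanished, so would every
    Ext^i(R/m, R/S) for ever larger proper ideals [S], each obtained by adding an element of [m]
    regular modulo the previous one. *)
Lemma Ext_depth_exists : exists d, Ext_depth X R^o d.
Proof.
suff [i hi] : exists i, ~ Ext_zero X R^o i.
  have ex : exists i, `[< ~ Ext_zero X R^o i >] by exists i; apply/asboolP.
  exists (ex_minn ex); case: ex_minnP => d /asboolP hd dmin; split=> // j jd.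
  apply: contrapT => /asboolP/dmin; by rewrite leqNgt jd.
apply: contrapT => allz.
have {}allz i : Ext_zero X R^o i by apply: contrapT => h; apply: allz; exists i.
pose F (S : submodule (R^o : lmodType R)) := ~ S 1 /\ forall i, Ext_zero X (quotmod S) i.
have [||S [S1 SX] Smax] := @noetherian_max _ R_noeth R^o F.
- exact: fg_regular.
- have Z0 : (0 : R^o) = 0 by [].
  have ZP (a : R) (x y : R^o) : x = 0 -> y = 0 -> a *: x + y = 0.
    by move=> -> ->; rewrite scaler0 addr0.
  exists (Submodule Z0 ZP); split; first by move/eqP; rewrite oner_eq0.
  have [//|r [s [rs sr]]] := @quotmod0_iso R^o (Submodule Z0 ZP).
  by move=> i; apply: Ext_zero_retract sr (allz i).
have [|x mx x_inj] := regular_of_Ext_zero R_noeth _ (SX 0%N).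
  by apply: fg_surj (quot_pi_surj (S := S)) (fg_regular R).
pose T (y : R^o) := exists (u z : R^o), S u /\ y = u + x *: z.
have T0 : T 0 by exists 0, 0; split; [exact: submod0|rewrite scaler0 addr0].
have TP a y z : T y -> T z -> T (a *: y + z).
  move=> [u [w [Su ->]]] [u' [w' [Su' ->]]]; exists (a *: u + u'), (a *: w + w').
  split; first exact: submodP.
  by rewrite !scalerDr !scalerA [x * a]mulrC addrACA.
have [//|q [q_surj qP]] := @quotmod_step R^o S (Submodule T0 TP) x.
have FT : F (Submodule T0 TP).
  split=> [[u [z [Su uz]]]|i].
    (* 1 = u + xz with [x] in [m] would make [u] a unit inside the proper ideal [S]. *)
    have : ~ m u.
      move=> mu; apply: (mfrak1 R_local); rewrite uz -[x *: z]/(x * z) mulrC.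
      by apply: (mfrakD R_local) mu _; exact: mfrakM.
    move=> /(unit_of_notin_mfrak R_noeth R_local)[y yu]; apply: S1.
    rewrite -yu -[y * u]addr0; apply: submodP => //; exact: submod0.
  have [h _] := Ext_zero_regular_quotient X_proj i mx x_inj q_surj qP.
  exact: h (SX i) (SX i.+1).
(* Maximality puts [x] into [S]; being regular modulo [S], it then forces 1 into [S]. *)
apply: S1; have : quot_pi S 1 = 0.
  apply: x_inj => /=; rewrite scaler0 -linearZ.
  apply/quot_pi_eq0; apply: (Smax _ FT) => [y Sy|].
    by exists y, 0; rewrite scaler0 addr0.
  by exists 0, 1; split; [exact: submod0|rewrite add0r].
by move/quot_pi_eq0.
Qed.

(** Coefficients indexed by all naturals survive [rcons] without casts between ordinal types. *)
Lemma ideal_mul_natP M (s : seq R) x : ideal_mul M s x <->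
  exists y : nat -> M, x = \sum_(i < size s) s`_i *: y i.
Proof.
split=> [[y ->]|[y ->]]; last by exists (fun i => y i).
exists (fun k => if insub k is Some i then y i else 0).
by apply: eq_bigr => i _; rewrite valK.
Qed.

Lemma ideal_mul_nil M x : ideal_mul M [::] x -> x = 0.
Proof. by move=> [y ->]; rewrite big_ord0. Qed.

Lemma ideal_mul_rcons M s a x : ideal_mul M (rcons s a) x <->
  exists u z, ideal_mul M s u /\ x = u + a *: z.
Proof.
rewrite ideal_mul_natP size_rcons; split=> [[y ->]|[u [z []]]].
  exists (\sum_(i < size s) s`_i *: y i), (y (size s)); split.
    by apply/ideal_mul_natP; exists y.
  rewrite big_ord_recr /= nth_rcons ltnn eqxx; congr (_ + _).
  by apply: eq_bigr => i _; rewrite nth_rcons ltn_ord.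
move=> /ideal_mul_natP[y ->] ->.
exists (fun k => if k == size s then z else y k).
rewrite big_ord_recr /= nth_rcons ltnn !eqxx; congr (_ + _).
by apply: eq_bigr => i _; rewrite nth_rcons ltn_ord ltn_eqF.
Qed.

Definition regular_at M (s : seq R) (a : R) : Prop :=
  injective (fun x : quotmod (ideal_mul M s) => a *: x).

(** The nonvanishing of the last quotient is left out, so that induction adds one element at a time;
    it is recovered from Ext in [depth_Ext]. *)
Definition regular_prefix M (s : seq R) : Prop :=
  (forall a, a \in s -> m a) /\
  forall i, (i < size s)%N -> regular_at M (take i s) s`_i.

Lemma regular_prefix_rcons M s a :
  regular_prefix M (rcons s a) <->
  [/\ regular_prefix M s, m a & regular_at M s a].
Proof.
split=> [[ms hs]|[[ms hs] ma ha]].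
  split; last 2 first.
  - by apply: ms; rewrite mem_rcons mem_head.
  - have := hs (size s); rewrite size_rcons => /(_ (ltnSn _)).
    by rewrite -cats1 take_size_cat // nth_cat ltnn subnn.
  split=> [b bs|i i_s]; first by apply: ms; rewrite mem_rcons inE bs orbT.
  have := hs i; rewrite size_rcons => /(_ (ltnW i_s)).
  by rewrite -cats1 takel_cat ?(ltnW i_s) // nth_cat i_s.
split=> [b|i]; first by rewrite mem_rcons inE => /orP[/eqP->|/ms].
rewrite size_rcons ltnS leq_eqVlt => /orP[/eqP->|i_s].
  by rewrite -cats1 take_size_cat // nth_cat ltnn subnn.
by rewrite -cats1 takel_cat ?(ltnW i_s) // nth_cat i_s; exact: hs.
Qed.

(** Each regular element gains one degree of vanishing. For k = 0 the hypothesis is void, which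
    gives the bound on the length of regular sequences. *)
Lemma Ext_zero_of_regular M s k : regular_prefix M s ->
  (forall j, (j < k)%N -> Ext_zero X (quotmod (ideal_mul M s)) j) ->
  forall j, (j < k + size s)%N -> Ext_zero X M j.
Proof.
elim/last_ind: s k => [|s a IHs] k hs hk j.
  rewrite addn0 => /hk; have [x h|r [t [rt _]]] := @quotmod0_iso M (ideal_mul M [::]).
    exact: ideal_mul_nil h.
  exact: Ext_zero_retract rt.
have /regular_prefix_rcons[hs' ma ha] := hs.
rewrite size_rcons addnS -addSn; apply: (IHs k.+1 hs') => {}j jk.
have [q [q_surj qP]] := quotmod_step (@ideal_mul_rcons M s a).
apply: (Ext_zero_regular_quotient X_proj j ma ha q_surj qP).2 => j' jj'.
by apply: hk; rewrite -ltnS -jj'.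
Qed.

Lemma fg_quotmod M (S : submodule M) : finitely_generated M -> finitely_generated (quotmod S).
Proof. exact: fg_surj (quot_pi_surj (S := S)). Qed.

(** While [e - k] is positive, Hom(R/m, -) vanishes on the current quotient and supplies the next
    regular element, which lowers the first nonzero degree by exactly one. *)
Lemma regular_of_Ext_depth M e k : finitely_generated M -> Ext_depth X M e -> (k <= e)%N ->
  exists s, [/\ size s = k, regular_prefix M s & Ext_depth X (quotmod (ideal_mul M s)) (e - k)].
Proof.
move=> M_fg [he ne]; elim: k => [|k IHk] ke.
  exists [::]; split=> //; rewrite subn0.
  have [x h|r [t [rt tr]]] := @quotmod0_iso M (ideal_mul M [::]); first exact: ideal_mul_nil h.
  split=> [i /he|h]; first exact: Ext_zero_retract tr.
  by apply: ne; exact: Ext_zero_retract rt h.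
have [s [sk hs [hz nz]]] := IHk (ltnW ke).
have es : (0 < e - k)%N by rewrite subn_gt0.
have [a ma ha] := regular_of_Ext_zero R_noeth (fg_quotmod _ M_fg) (hz 0%N es).
have [q [q_surj qP]] := quotmod_step (@ideal_mul_rcons M s a).
have hq i := Ext_zero_regular_quotient X_proj i ma ha q_surj qP.
exists (rcons s a); split; first by rewrite size_rcons sk.
  exact/regular_prefix_rcons.
rewrite subnS; split=> [i hi|h].
  by apply: (hq i).1; apply: hz; rewrite -?ltn_predRL // (leq_trans hi) // leq_pred.
apply: nz; apply: (hq _).2 => j ej; move: h; by rewrite ej.
Qed.

End DepthExt.

(** * The Auslander-Bridger formula *)

Section DepthGdim.
Variables (R : comNzRingType) (m : set R).
Hypotheses (R_noeth : noetherian R) (R_local : local_ring m).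
Implicit Types A B C G K L M N U V : lmodType R.
Local Notation free n := {ffun 'I_n -> R^o}.
Variable X : resolution (residue R_local).
Hypothesis X_proj : projective_resolution X.
Variable d : nat.
Hypothesis R_depth : Ext_depth X R^o d.

Lemma tot_refl_Ext_zero G i : tot_refl G -> (i < d)%N -> Ext_zero X G i.
Proof.
elim: i G => [|i IHi] G hG hid; have [n [a [C [b [hab hC _]]]]] := tot_refl_embed R_noeth hG;
  apply: (Ext_zero_ker X_proj hab (Ext_zero_ffun (R_depth.1 _ hid))) => j //.
by case=> <-; apply: IHi => //; exact: ltnW.
Qed.

(** Injectivity of Ext^d(R/m, G) -> Hom(G^*, Ext^d(R/m, R)): Ext^(d-1)(R/m, C) = 0 embeds the source
    into Ext^d(R/m, R^n), where the coordinate functionals decide. *)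
Lemma tot_refl_coboundary G (xi : {linear X d -> G}) : tot_refl G ->
  (forall f : {linear G -> R^o}, coboundary (f \o xi)) -> coboundary xi.
Proof.
move=> hG hxi; have [n [a [C [b [hab hC _]]]]] := tot_refl_embed R_noeth hG.
apply: (coboundary_pull X_proj hab) => [j dj|].
  by apply: tot_refl_Ext_zero => //; rewrite dj.
apply: coboundary_ffun => k g gE; have [p pP] := @free_coord R n k.
by apply: coboundary_eq (hxi (p \o a)) => x; rewrite gE -pP.
Qed.

(* Ext^d(R/m, G) = Hom(G^*, Ext^d(R/m, R)): every map G^* -> R/m -> Ext^d(R/m, R),
   the second arrow sending 1 to the class of v, is evaluation at some class xi. *)
Lemma tot_refl_realize G (c : {linear dual G -> residue R_local}) (v : {linear X d -> R^o}) :
  tot_refl G -> cocycle v ->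
  exists2 xi : {linear X d -> G}, cocycle xi &
    forall (f : dual G) (r : R), c f = res_pi R_local r ->
      coboundary ((f \o xi) \- (r \*: v)).
Proof.
move=> hG cv; have [n [a [C [b [hab hC span_a]]]]] := tot_refl_embed R_noeth hG.
have [p pP] := choice (@free_coord R n).
have [r rP] := choice (fun i => res_pi_surj (c ((p i \o a) : {linear G -> R^o}))).
(* [w] has the coordinates r_i v; by [pairing], a functional with coefficients [t] multiplies [v] by
   the very scalar whose residue is the value of [c]. *)
have [w wP] : exists w : {linear X d -> free n}, forall x, w x = [ffun i => r i * v x].
  apply: (@lin_of_rel _ (X d) (free n) (fun x y => y = [ffun i => r i * v x])) => [x|e x x' y y' -> ->|y ->].
  - by eexists.
  - apply/ffunP => i; rewrite !ffunE linearP mulrDr; congr (_ + _).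
    by rewrite -[e *: v x]/(e * v x) mulrCA.
  - by apply/ffunP => i; rewrite !ffunE linear0 mulr0.
have cw : cocycle w by move=> y; apply/ffunP => i; rewrite wP !ffunE cv mulr0.
have pairing (t : 'I_n -> R) (g : {linear free n -> R^o}) :
    (forall y, g y = \sum_i t i * y i) ->
    (forall x, g (w x) = (\sum_i t i * r i) * v x) /\
    c ((g \o a) : {linear G -> R^o}) = res_pi R_local (\sum_i t i * r i).
  move=> gE; split=> [x|].
    by rewrite gE mulr_suml; apply: eq_bigr => i _; rewrite wP ffunE mulrA.
  have -> : ((g \o a : {linear G -> R^o}) : dual G) =
      \sum_i t i *: ((p i \o a : {linear G -> R^o}) : dual G).
    apply: hom_ext => x; rewrite /= gE.
    transitivity (\sum_i t i *: p i (a x)); first by apply: eq_bigr => i _; rewrite pP.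
    by elim/big_rec2: _ => // i u u' _ ->.
  rewrite !linear_sum; apply: eq_bigr => i _.
  by rewrite linearZ /= -rP -res_piM.
(* A functional on [C] pulls back to one vanishing on [G], so its scalar has residue 0, lies in [m],
   and kills Ext. Hence [w] comes from [G] up to a coboundary. *)
have cbw : coboundary (b \o w).
  apply: tot_refl_coboundary => // f.
  pose t i := f (b (free_basis R i)).
  have gE y : (f \o b) y = \sum_i t i * y i.
    rewrite /= [in LHS](free_sum y) !linear_sum; apply: eq_bigr => i _.
    by rewrite !linearZ /= -[_ *: _]/(_ * _) mulrC.
  have [fw cf] := pairing t (f \o b) gE.
  apply: (residue_Ext_ann X_proj (r := \sum_i t i * r i) _ cv) => [|x]; last exact: fw.
  apply/(res_pi_eq0 R_local); rewrite -cf.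
  rewrite (_ : ((f \o b) \o a : {linear G -> R^o}) = 0 :> dual G) ?linear0 //.
  by apply: hom_ext => x; rewrite /= (ses_comp0 x hab) linear0.
have [xi cxi [e ce wE]] := cocycle_lift X_proj hab cw cbw.
exists xi => // f s fs; have [t ft] := span_a f.
have [g gP] := free_hom (V := R^o) t.
have gE y : g y = \sum_i t i * y i.
  by rewrite gP; apply: eq_bigr => i _; rewrite -[_ *: _]/(_ * _) mulrC.
have [gw cg] := pairing t g gE.
have fga : f = ((g \o a : {linear G -> R^o}) : dual G).
  by apply: hom_ext => x; rewrite ft /= gE.
have mts : m (\sum_i t i * r i - s).
  by apply/(res_pi_eq0 R_local); rewrite linearB -cg -fga fs subrr.
have cv' := residue_Ext_ann X_proj mts cv (g := (\sum_i t i * r i - s) \*: v) (fun x => erefl).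
apply: (coboundary_comb (a := - 1) (f := g \o e)) cv' => [x|]; last exact: coboundary_comp.
rewrite scaleN1r /= scalerBl fga /= addrA; congr (_ - _).
have -> : (\sum_i t i * r i) *: v x = g (a (xi x) + e x) by rewrite -wE gw.
by rewrite linearD addrC addrK.
Qed.

Lemma Ext_zeroPn N i : ~ Ext_zero X N i ->
  exists2 v : {linear X i -> N}, cocycle v & ~ coboundary v.
Proof.
move=> nz; apply: contrapT => h; apply: nz => v cv.
by apply: contrapT => nv; apply: h; exists v.
Qed.

(** G^* is nonzero, so some [c] takes the value 1 at some [f]; for [xi] realizing [c], the composite
    [f \o xi] is cohomologous to the nonzero class [v]. *)
Lemma tot_refl_Ext_depth G : tot_refl G -> nonzero_module G -> Ext_depth X G d.
Proof.
move=> hG [x /eqP x0]; split=> [i|hz]; first exact: tot_refl_Ext_zero.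
have [fgG /reflexiveP[Ginj _] _] := hG.
have [c [f fc]] : exists (c : {linear dual G -> residue R_local}) f, c f = res_pi R_local 1.
  apply: residue_map => //; first exact: fg_dual.
  apply: contrapT => /nonzeroPn D0; apply: x0; apply: Ginj => f.
  by rewrite (D0 f : f = 0 :> dual G).
have [v cv nv] := Ext_zeroPn R_depth.2.
have [xi cxi /(_ f 1 fc) h] := tot_refl_realize c hG cv.
apply: nv; apply: (coboundary_comb (a := - 1)) h (coboundary_comp f (hz _ cxi)) => y /=.
by rewrite scaleN1r scale1r opprB subrK.
Qed.

Lemma Gdim_Ext_depth n M : Gdim_le n M ->
  Gdim_sharp n M ->
  (n <= d)%N /\ Ext_depth X M (d - n).
Proof.
elim: n M => [|n IHn] M.
  by move=> hM M0; rewrite subn0; split=> //; exact: tot_refl_Ext_depth.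
move=> [K [G [j [q [hj hG hK]]]]] nM; have [_ _ EG] := hG.
(* A nonzero class of Ext^(d-n-1)(R/m, M) is detected through its image in Ext^(d-n)(R/m, K): a
   nonzero class that dies in [G]. *)
suff [nd Kz [xi cxi [nxi jxi]]] : [/\ (n <= d)%N,
    forall i, (i < d - n)%N -> Ext_zero X K i &
    exists2 xi : {linear X (d - n)%N -> K}, cocycle xi & ~ coboundary xi /\ coboundary (j \o xi)].
  (* In degree 0 a class killed by the injective [j] is itself zero; so d - n > 0, which is also the
     bound asserted. *)
  have [e de] : exists e, (d - n)%N = e.+1.
    case: (d - n)%N xi cxi nxi jxi => [|e] xi cxi nxi jxi; last by exists e.
    by case: nxi => x; case: hj => /ker_of_inj jK _ _; apply: jK; exact: jxi.
  rewrite de in Kz xi cxi nxi jxi.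
  have ed : (e < d)%N by rewrite -de leq_subr.
  have n_d : (n < d)%N by rewrite -subn_gt0 de.
  rewrite subnS de /=; split=> //; split=> [i ie|hz].
    apply: (Ext_zero_coker X_proj hj); last exact: Kz.
    by apply: tot_refl_Ext_zero => //; exact: ltn_trans ed.
  by apply: nxi; apply: (coboundary_pull X_proj hj) => // _ [<-].
case: n IHn hK nM => [|n] IHn hK nM.
  rewrite subn0; split=> // [i|]; first exact: tot_refl_Ext_zero.
  have S0 : exists f : dual G, precomp (N := R^o) j f = 0 by exists 0; exact: linear0.
  have SP c y z : (exists f : dual G, precomp (N := R^o) j f = y) ->
      (exists f : dual G, precomp (N := R^o) j f = z) ->
      exists f : dual G, precomp (N := R^o) j f = c *: y + z.
    by move=> [u <-] [w <-]; exists (c *: u + w); rewrite linearP.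
  (* [E] is Ext^1(M, R), because Ext^1(G, R) = 0. A class realizing K^* -> E -> R/m is nonzero, yet
     every functional that comes from [G] sends it to a coboundary. *)
  pose E := quotmod (Submodule S0 SP).
  have [c [z cz]] : exists (c : {linear E -> residue R_local}) z, c z = res_pi R_local 1.
    apply: residue_map => //.
      apply: fg_surj (quot_pi_surj (S := Submodule S0 SP)) _; apply: fg_dual => //.
      by case: hK.
    apply: contrapT => /nonzeroPn E0; apply: nM.
    apply: (Ext_van_coker0 hj) (EG 0%N).1 => f.
    have /quot_pi_eq0[g gf] := E0 (quot_pi (Submodule S0 SP) (f : dual K)).
    by exists (g : {linear G -> R^o}) => x; exact: (congr1 (fun u : dual K => u x) gf).
  have [f0 f0z] := quot_pi_surj z.
  have [v cv nv] := Ext_zeroPn R_depth.2.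
  have [xi cxi xiP] := tot_refl_realize (c \o quot_pi (Submodule S0 SP)) hK cv.
  exists xi => //; split=> [cb|].
    have h := xiP f0 1 (etrans (congr1 c f0z) cz).
    apply: nv; apply: (coboundary_comb (a := - 1)) h (coboundary_comp f0 cb) => y /=.
    by rewrite scaleN1r scale1r opprB subrK.
  apply: tot_refl_coboundary => // f.
  have f_im : quot_pi (Submodule S0 SP) (precomp (N := R^o) j f) = 0.
    by apply/quot_pi_eq0; exists (f : dual G).
  have cf : (c \o quot_pi (Submodule S0 SP)) (precomp (N := R^o) j f) = res_pi R_local 0.
    by rewrite /= f_im !linear0.
  by apply: coboundary_eq (xiP _ 0 cf) => x /=; rewrite scale0r subr0.
(* Now the degree is below [d], so every class dies in [G] and any nonzero class of [K] serves. *)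
have [||nd [Kz nz]] := IHn K => //.
  by move=> hz; apply: nM; exact: Ext_van_coker hj hz (EG n.+1).1.
have [xi cxi nxi] := Ext_zeroPn nz.
split=> //; exists xi => //; split=> //.
apply: (tot_refl_Ext_zero hG); last exact: cocycle_comp.
by rewrite -subn_gt0 subKn.
Qed.

End DepthGdim.

(** * Suprema and infima of sets of integers *)

Section IntegerSuprema.
Local Open Scope ereal_scope.
Local Open Scope classical_set_scope.
Import Order.TTheory Num.Theory.

Lemma supremum_eq (S : set (\bar int)) x0 x : S !=set0 ->
  (forall y, S y -> y <= x) -> (forall z, (forall y, S y -> y <= z) -> x <= z) ->
  supremum x0 S = x.
Proof.
move=> /set0P S0 ub lub; rewrite /supremum (negPf S0); apply: xget_unique.
  by split=> [y /ub|y yub] //; apply: lub.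
by move=> y [yub ylub]; apply/eqP; rewrite eq_le lub // andbT; apply: ylub.
Qed.

Lemma infimum_eq (S : set (\bar int)) x0 x : S !=set0 ->
  (forall y, S y -> x <= y) -> (forall z, (forall y, S y -> z <= y) -> z <= x) ->
  infimum x0 S = x.
Proof.
move=> /set0P S0 lb glb; rewrite /infimum (negPf S0); apply: xget_unique.
  by split=> [y /lb|y yub] //; apply: glb.
by move=> y [ylb yglb]; apply/eqP; rewrite eq_le glb //=; apply: yglb.
Qed.

Lemma infimum_set0 (S : set (\bar int)) x0 : ~ (S !=set0) -> infimum x0 S = x0.
Proof. by move=> S0; rewrite /infimum ifT //; apply/eqP/seteqP; split=> // x Sx; case: S0; exists x. Qed.

Lemma supremum_unbounded (A : set int) x0 : (forall b, exists2 i, A i & (b <= i)%R) ->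
  supremum x0 [set i%:E | i in A] = +oo.
Proof.
move=> hA; apply: supremum_eq => [|y _|z zub]; last 2 first.
- exact: leey.
- case: z zub => [r||] zub; last 2 first.
  + by [].
  + by have [i Ai _] := hA 0%R; have := zub i%:E; rewrite leeNy_eq; apply; exists i.
  have [i Ai ri] := hA (r + 1)%R; have := zub i%:E; rewrite lee_fin => h.
  have /(le_trans ri) : (i <= r)%R by apply: h; exists i.
  by rewrite gerDl ler10.
by have [i Ai _] := hA 0%R; exists i%:E, i.
Qed.

Lemma infimum_unbounded (A : set int) x0 : (forall b, exists2 i, A i & (i <= b)%R) ->
  infimum x0 [set i%:E | i in A] = -oo.
Proof.
move=> hA; apply: infimum_eq => [|y _|z zub]; last 2 first.
- exact: leNye.
- case: z zub => [r||] zub; last 2 first.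
  + by have [i Ai _] := hA 0%R; have := zub i%:E; rewrite leye_eq; apply; exists i.
  + by [].
  have [i Ai ri] := hA (r - 1)%R; have := zub i%:E; rewrite lee_fin => h.
  have /le_trans/(_ ri) : (r <= i)%R by apply: h; exists i.
  by rewrite lerDl oppr_ge0 ler10.
by have [i Ai _] := hA 0%R; exists i%:E, i.
Qed.

End IntegerSuprema.

Section DepthValue.
Import Order.TTheory Num.Theory.
Variables (R : comNzRingType) (m : set R).
Hypotheses (R_noeth : noetherian R) (R_local : local_ring m).
Variable X : resolution (residue R_local).
Hypothesis X_proj : projective_resolution X.

Lemma depth_Ext (M : lmodType R) e : finitely_generated M ->
  Ext_depth X M e -> depth m M = (e%:Z)%:E.
Proof.
move=> M_fg hM; have [hz nz] := hM.
have [s [sz [ms hs]]] := regular_of_Ext_depth R_noeth X_proj M_fg hM (leqnn e).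
rewrite subnn => -[_ nQ].
(* The last quotient is nonzero since Hom(R/m, -) does not vanish on it. *)
have Ss : regular_sequence M s.
  split=> //; apply: contrapT => /nonzeroPn Q0; apply: nQ.
  exact: Ext_zero_triv.
apply: supremum_eq => [|y [t [mt [ht _]] <-]|z zub].
- by exists ((size s)%:Z)%:E, s.
- rewrite lee_fin lez_nat leqNgt; apply/negP => e_t; apply: nz.
  by apply: (Ext_zero_of_regular (k := 0) X_proj (conj mt ht)).
- by rewrite -sz; apply: zub; exists s.
Qed.

End DepthValue.

(** * Bounded complexes of projectives *)

Section Complexes.
Import Order.TTheory Num.Theory.
Variables (R : comNzRingType) (R_noeth : noetherian R).
Implicit Types M N Q : lmodType R.
Local Notation free n := {ffun 'I_n -> R^o}.

Lemma Ext_zero_fg_projective M (X : resolution M) Q i :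
  projective Q -> finitely_generated Q -> Ext_zero X R^o i -> Ext_zero X Q i.
Proof.
move=> hQ /fg_cover[n [f f_surj]] hR.
have [s fs] := surj_projective_split hQ f_surj.
exact: Ext_zero_retract fs (Ext_zero_ffun hR).
Qed.

Definition cycles (P : complex R) i : lmodType R := kermod (cx_diff P i (i - 1)).

(** [B] stands for the i-boundaries, realized as the kernel of Z_i -> H_i. The complex enters the
    inductions below through these two sequences. *)
Lemma cycles_ses (P : complex R) i :
  exists (B : lmodType R) (a : {linear B -> cycles P i})
    (h : {linear cycles P i -> cx_homology P i})
    (k : {linear cycles P (i + 1) -> P (i + 1)}) (e : {linear P (i + 1) -> B}),
    ses a h /\ ses k e.
Proof.
pose S := boundaries (cx_diff P (i + 1) i) (cx_diff P i (i - 1)).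
have [|t tP] := kermod_lift (f := cx_diff P i (i - 1)) (h := cx_diff P (i + 1) i).
  by move=> w; exact: cx_diffK.
have [|e eP] := kermod_lift (f := quot_pi S) (h := t).
  by move=> w; apply/quot_pi_eq0; exists w; rewrite tP.
exists (kermod (quot_pi S)), val, (quot_pi S), val, e.
split; first exact/ses_kermod/quot_pi_surj.
split=> [x y|[z Sz]|y]; first exact: val_inj.
  have /quot_pi_eq0[u uz] := eqP Sz.
  by exists u; apply: val_inj; apply: val_inj; rewrite eP tP.
(* [cycles P (i + 1)] uses the differential into degree i + 1 - 1, equal but not convertible to
   [i]. *)
have ker_j j : j = i -> cx_diff P (i + 1) i y = 0 <-> cx_diff P (i + 1) j y = 0.
  by move=> ->.
have -> : e y = 0 <-> cx_diff P (i + 1) i y = 0.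
  split=> [ey|dy]; first by rewrite -tP -eP ey.
  by apply: val_inj; rewrite eP; apply: val_inj; rewrite tP dy.
rewrite (ker_j (i + 1 - 1)) ?addrK //; split=> [/kermod_ex|[x <-]]; first by [].
exact: kermodP.
Qed.

Lemma homology_zero (P : complex R) i : (forall x : P i, x = 0) ->
  forall x : cx_homology P i, x = 0.
Proof.
move=> P0 x; have [z <-] := quot_pi_surj x.
by rewrite (_ : z = 0) ?linear0 //; apply: val_inj; rewrite [LHS]P0 [RHS]P0.
Qed.

(* A bounded complex of finitely generated projectives starting, up to homotopy,
   in degree b. *)
Section BoundedComplex.
Variables (P : complex R) (l u b : int).
Hypothesis P_proj : forall i, projective (P i) /\ finitely_generated (P i).
Hypothesis P_low : forall i : int, i < l -> forall x : P i, x = 0.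
Hypothesis P_high : forall i : int, u < i -> forall x : P i, x = 0.
Hypothesis H_low : forall i : int, i < b -> forall x : cx_homology P i, x = 0.

Lemma cycles_fg i : finitely_generated (cycles P i).
Proof. by apply: (fg_inj R_noeth (f := val)) (P_proj i).2 => x y; exact: val_inj. Qed.

(** Below [b] boundaries are cycles, so P_(i+1) -> Z_i splits once Z_i is projective, and its kernel
    Z_(i+1) is projective. The start is l - 1, where the complex is zero. *)
Lemma cycles_projective (i : int) : i <= b -> projective (cycles P i).
Proof.
have zero_low j : j < l -> projective (cycles P j).
  by move=> jl; apply: projective_zero => x; apply: val_inj; rewrite [LHS]P_low ?[RHS]P_low.
suff h n : l - 1 + n%:Z <= b -> projective (cycles P (l - 1 + n%:Z)).
  have [/zero_low //|li ib] := Order.TotalTheory.ltP i l.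
  have := h (absz (i - l + 1)%R); rewrite gez0_abs; last by lia.
  have -> : l - 1 + (i - l + 1) = i by lia.
  by apply.
elim: n => [|n IHn]; first by rewrite addr0 => _; apply: zero_low; rewrite ltrBlDr ltrDl.
rewrite -addn1 PoszD addrA => nb; set k0 := l - 1 + n%:Z in IHn nb *.
have ib : k0 < b by apply: lt_le_trans nb; rewrite ltrDl.
have [B [a [h [k [e [hah hke]]]]]] := cycles_ses P k0.
apply: (ses_projective_projective hke (P_proj _).1).
have [|r rP] := ses_lift (f := idfun) hah; first by move=> w; exact: H_low.
apply: (projective_retract (r := r) (s := a)) (IHn (ltW ib)) _ => x.
by case: hah => a_inj _ _; apply: a_inj; rewrite rP.
Qed.

Variables (M : lmodType R) (X : resolution M).
Hypothesis X_proj : projective_resolution X.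

(** Descending induction from u + 1, where the cycles are zero. A step down uses Ext^(j+1) of
    Z_(i+1), so all degrees above [c] are carried along. *)
Lemma cycles_Ext_zero c :
  (forall j, (c < j)%N -> Ext_zero X R^o j) ->
  (forall i j, (c < j)%N -> Ext_zero X (cx_homology P i) j) ->
  forall i j, (c < j)%N -> Ext_zero X (cycles P i) j.
Proof.
move=> hR hH i j cj.
have hfree k n : (c < k)%N -> Ext_zero X (free n) k.
  by move=> ck; exact/Ext_zero_ffun/hR.
have hP k n : (c < k)%N -> Ext_zero X (P n) k.
  by move=> ck; exact/(Ext_zero_fg_projective (P_proj n).1 (P_proj n).2)/hR.
have zero_high (n : int) : u < n -> forall k, Ext_zero X (cycles P n) k.
  move=> un k; apply: Ext_zero_triv => x; apply: val_inj.
  by rewrite [LHS]P_high ?[RHS]P_high.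
suff h n k : (c < k)%N -> Ext_zero X (cycles P (u + 1 - n%:Z)) k.
  have [ui|iu] := Order.TotalTheory.ltP u i; first exact: zero_high.
  have := h (absz (u - i + 1)%R) j cj; rewrite gez0_abs; last by lia.
  by have -> : u + 1 - (u - i + 1) = i by lia.
elim: n k => [|n IHn] k ck; first by apply: zero_high; rewrite subr0 ltrDl.
have [B [a [h [s [e [hah hke]]]]]] := cycles_ses P (u + 1 - n.+1%:Z).
rewrite (_ : u + 1 - n.+1%:Z + 1 = u + 1 - n%:Z) in s e hke; last by lia.
apply: (Ext_zero_ext X_proj hah); last exact: hH.
by apply: (Ext_zero_coker X_proj hke); [exact: hP | exact/IHn/ltnW].
Qed.

Hypothesis Hb_nz : nonzero_module (cx_homology P b).

(* The top nonvanishing Ext^p(M, N) survives to the hyperext of M with P. *)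
Lemma homology_Ext_zero p :
  (forall j, (p <= j)%N -> Ext_zero X R^o j) ->
  (forall i j, (p < j)%N -> Ext_zero X (cx_homology P i) j) ->
  Ext_zero X (cx_homology P b) p.
Proof.
move=> hR hH.
have hZ := cycles_Ext_zero (fun j pj => hR j (ltnW pj)) hH.
have [B [a [h [s [e [hah hke]]]]]] := cycles_ses P b.
apply: (Ext_zero_coker X_proj hah).
  exact: Ext_zero_fg_projective (cycles_projective (lexx b)) (cycles_fg b) (hR p (leqnn p)).
apply: (Ext_zero_coker X_proj hke); last exact/hZ.
exact: Ext_zero_fg_projective (P_proj _).1 (P_proj _).2 (hR _ (leqnSn p)).
Qed.

Variable m : set R.
Hypothesis R_local : local_ring m.

(* Ext^g(M, R) is a quotient of Ext^g(M, Z_b), hence of Ext^g(M, P_(b+1)), by a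
   map with entries in m; conclude by Nakayama. *)
Lemma regular_Ext_zero g : finitely_generated (X g) ->
  (forall j, (g < j)%N -> Ext_zero X R^o j) ->
  (forall i j, (g <= j)%N -> Ext_zero X (cx_homology P i) j) ->
  Ext_zero X R^o g.
Proof.
move=> Xg_fg hR hH.
have hZ := cycles_Ext_zero hR (fun i j gj => hH i j (ltnW gj)).
have [B [a [h [s [e [hah hke]]]]]] := cycles_ses P b.
have Hfg : finitely_generated (cx_homology P b).
  by case: hah => _ h_surj _; exact: fg_surj h_surj (cycles_fg b).
have [c [y cy]] := residue_map R_noeth R_local Hfg Hb_nz.
(* Projectivity of Z_b lifts H_b -> R/m to a functional [phi] that is a unit at [z0] and has values
   in [m] on boundaries. *)
have [phi phiP] := cycles_projective (lexx b) (c \o h) (@res_pi_surj _ _ R_local).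
have [z0 hz0] : exists z, h z = y by case: hah => _ h_surj _; exact: h_surj.
have phi_z0 : ~ m (phi z0).
  by move=> /(res_pi_eq0 R_local); rewrite phiP /= hz0 cy; exact: (@res_pi1_neq0 _ _ R_local).
have [t tz0] := unit_of_notin_mfrak R_noeth R_local phi_z0.
have [n [pi pi_surj]] := fg_cover (P_proj (b + 1)).2.
have [sec pi_sec] := surj_projective_split (P_proj (b + 1)).1 pi_surj.
pose theta : {linear P (b + 1) -> R^o} := phi \o a \o e.
have theta_m x : m (theta x).
  by apply/(res_pi_eq0 R_local); rewrite /theta /= phiP /= (ses_comp0 _ hah) linear0.
have [pr prP] := choice (@free_coord R n).
(* This says Ext^g(M, R) = m Ext^g(M, R). The cochain [w] satisfies phi \o w = f; up to a coboundary
   it comes from P_(b+1), on which [theta] takes values in [m]. *)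
have main (f : {linear X g -> R^o}) : cocycle f ->
    exists (r : 'I_n -> R) (v : 'I_n -> {linear X g -> R^o}) (e' : {linear X g -> R^o}),
      [/\ forall i, m (r i), forall i, cocycle (v i), coboundary e' &
          forall x, f x = \sum_i r i * v i x + e' x].
  move=> cf.
  have [w wP] : exists w : {linear X g -> cycles P b}, forall x, w x = (f x * t) *: z0.
    apply: (@lin_of_rel _ (X g) (cycles P b) (fun x y => y = (f x * t) *: z0)) => [x|d x x' v v' -> ->|v ->].
    - by eexists.
    - by rewrite linearP -[d *: f x]/(d * f x) mulrDl scalerDl -mulrA scalerA.
    - by rewrite linear0 mul0r scale0r.
  have cw : cocycle w by move=> x; rewrite wP cf mul0r scale0r.
  have [f1 cf1 [e1 ce1 wE]] := cocycle_lift X_proj hah cw (hH b g (leqnn g) _ (cocycle_comp h cw)).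
  have [f2 cf2 f2E] := cocycle_connect X_proj hke (hZ _ _ (ltnSn g)) cf1.
  exists (fun i => theta (pi (free_basis R i))), (fun i => pr i \o sec \o f2), (phi \o e1).
  split=> [i|i||x]; [exact: theta_m | exact: cocycle_comp | exact: coboundary_comp |].
  have -> : f x = phi (w x).
    by rewrite wP linearZ /= -[_ *: phi z0]/(_ * phi z0) -mulrA tz0 mulr1.
  rewrite wE linearD -f2E; congr (_ + _).
  rewrite -[LHS]/(theta (f2 x)) -[f2 x in LHS]pi_sec (free_sum (sec (f2 x))) !linear_sum.
  by apply: eq_bigr => i _; rewrite !linearZ /= -[_ *: _]/(_ * _) mulrC prP.
(* Ext^g(M, R) is formed as cocycles modulo [coboundary], uniformly in [g], whereas [hom_cohomology]
   treats degree 0 apart. *)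
pose D := precomp (N := R^o) (res_diff X g) : {linear linhom (X g) R^o -> linhom (X g.+1) R^o}.
pose rep (k : kermod D) : {linear X g -> R^o} := val k.
have rep_lin r k k' x : rep (r *: k + k') x = r *: rep k x + rep k' x.
  have valP := linearP (val : {linear kermod D -> linhom (X g) R^o}) r k k'.
  exact: (congr1 (fun f : linhom (X g) R^o => f x) valP).
have cker k : cocycle (rep k).
  by move=> x; exact: (congr1 (fun f : linhom _ _ => f x) (kermodP k)).
have kerc (f : {linear X g -> R^o}) : cocycle f -> exists k, rep k = f.
  move=> cf; have [|k kf] := @kermod_ex _ _ _ D f; last by exists k.
  by apply: hom_ext => x; exact: cf.
have S0 : coboundary (rep 0).
  have cob0 : coboundary (\0 : {linear X g -> R^o}).
    by case: (g) => [|j] /=; [|exists \0].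
  exact: coboundary_eq cob0.
have SP (r : R) k k' : coboundary (rep k) -> coboundary (rep k') ->
    coboundary (rep (r *: k + k')).
  exact: (coboundary_comb (a := r) (f := rep k) (g := rep k') (rep_lin r k k')).
pose S : submodule (kermod D) :=
  @Submodule R (kermod D) (fun k => coboundary (rep k)) S0 SP.
apply: contrapT => nz.
have [k0 nk0] : exists k : kermod D, ~ S k.
  apply: contrapT => hk; apply: nz => f cf; have [k kf] := kerc f cf.
  by apply: contrapT => nf; apply: hk; exists k; rewrite /S /= kf.
have [||q [x qx]] := residue_map R_noeth R_local (L := quotmod S).
- apply: fg_surj (quot_pi_surj (S := S)) _.
  apply: (fg_inj R_noeth (f := val)) (fg_dual R_noeth Xg_fg) => k k'; exact: val_inj.
- by exists (quot_pi S k0); apply/eqP => /quot_pi_eq0.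
have [k kx] := quot_pi_surj x.
have [r [v [e' [mr cv ce' kE]]]] := main _ (cker k).
have [v' v'E] := choice (fun i => kerc _ (cv i)).
apply: (@res_pi1_neq0 _ _ R_local); rewrite -qx -kx.
have kS : S (- 1 *: (\sum_i r i *: v' i) + k).
  have sumE x' : rep (\sum_i r i *: v' i) x' = \sum_i r i * v i x'.
    transitivity (\sum_i r i * rep (v' i) x').
      by elim/big_rec2: _ => // i y1 y2 _ <-; exact: rep_lin.
    by apply: eq_bigr => i _; rewrite v'E.
  by apply: coboundary_eq ce' => x'; rewrite rep_lin sumE kE scaleN1r addKr.
have piE : 0 = - 1 *: quot_pi S (\sum_i r i *: v' i) + quot_pi S k :=
  etrans (esym (iffRL (quot_pi_eq0 S _) kS)) (quot_pi_is_linear S (- 1) _ _).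
have kE' : quot_pi S k = quot_pi S (\sum_i r i *: v' i).
  by apply/eqP; rewrite -subr_eq0 addrC -scaleN1r -piE.
apply: etrans (congr1 q kE') _.
by rewrite !linear_sum big1 // => i _; rewrite !linearZ /= residue_ann.
Qed.

End BoundedComplex.

End Complexes.

(** * Unpacking finite quasi-projective dimension *)

Section QuasiProjective.
Import Order.TTheory Num.Theory.
Variable R : comNzRingType.
Implicit Types M N : lmodType R.

Lemma inf_finite_bounded (A : set int) :
  (-oo < infimum +oo [set i%:E | i in A])%E -> exists l, forall i, A i -> l <= i.
Proof.
move=> hA; apply: contrapT => nl; move: hA.
rewrite infimum_unbounded ?ltxx // => b; apply: contrapT => nb; apply: nl.
exists b => i Ai; rewrite leNgt; apply/negP => ib; apply: nb.
by exists i => //; exact: ltW.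
Qed.

(** A nonempty set of integers bounded below attains its minimum, found by [ex_minn] after a shift
    by [l]. *)
Lemma infimum_le (A : set int) l i :
  (forall j, A j -> l <= j) -> A i -> (infimum +oo [set j%:E | j in A] <= i%:E)%E.
Proof.
move=> hl Ai.
have ex : exists k : nat, `[< A (l + k%:Z) >].
  exists (absz (i - l)); apply/asboolP; have li := hl _ Ai.
  by have -> : l + (absz (i - l))%:Z = i by lia.
have [k /asboolP Ak kmin] := ex_minnP ex.
rewrite (@infimum_eq _ _ (l + k%:Z)%:E).
- rewrite lee_fin; have li := hl _ Ai.
  have : (k <= absz (i - l))%N; last by lia.
  apply: kmin; apply/asboolP.
  by have -> : l + (absz (i - l))%:Z = i by lia.
- by exists i%:E, i.
- move=> _ [j Aj <-]; rewrite lee_fin; have lj := hl _ Aj.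
  have : (k <= absz (j - l))%N; last by lia.
  apply: kmin; apply/asboolP.
  by have -> : l + (absz (j - l))%:Z = j by lia.
- by move=> z; apply; exists (l + k%:Z).
Qed.

Lemma sup_finite_bounded (A : set int) x0 :
  (supremum x0 [set i%:E | i in A] < +oo)%E -> exists u, forall i, A i -> i <= u.
Proof.
move=> hA; apply: contrapT => nl; move: hA.
rewrite supremum_unbounded ?ltxx // => b; apply: contrapT => nb; apply: nl.
exists b => i Ai; rewrite leNgt; apply/negP => ib; apply: nb.
by exists i => //; exact: ltW.
Qed.

Lemma bounded_above (P : complex R) : bounded_below P -> bounded P ->
  (exists i, (cx_inf P <= i%:E)%E) ->
  exists u, forall i : int, u < i -> forall x : P i, x = 0.
Proof.
move=> Pb PB [i0 hi0].
(* The bound on sup - inf controls sup once inf is finite: [Pb] excludes -oo and [hi0] excludes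
   +oo. *)
have : (cx_sup P < +oo)%E.
  have : cx_inf P \is a fin_num.
    by rewrite fin_numE -!ltNye -!ltey Pb (le_lt_trans hi0) ?ltey.
  move: PB; rewrite /bounded; case: (cx_inf P) => // r; case: (cx_sup P) => // s _ _; exact: ltry.
move=> sP; have [u hu] := sup_finite_bounded sP; exists u => i ui; apply/nonzeroPn => /hu.
by rewrite leNgt ui.
Qed.

Lemma qpd_data N : nonzero_module N -> (qpd N < +oo)%E ->
  exists (P : complex R) (l u b : int),
    [/\ forall i, projective (P i) /\ finitely_generated (P i),
        forall i : int, i < l -> forall x : P i, x = 0,
        forall i : int, u < i -> forall x : P i, x = 0,
        forall i : int, i < b -> forall x : cx_homology P i, x = 0 &
        nonzero_module (cx_homology P b) /\
        forall i, nonzero_module (cx_homology P i) ->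
          exists n, isomorphic (cx_homology P i) {ffun 'I_n -> N}].
Proof.
move=> [y0 y0n] qN.
have [P [[Pb Pfg [a [[i0 i0P ai0] aP]]] PB]] :
    exists P, quasi_projective_resolution N P /\ bounded P.
  (* Over an empty set of resolutions the infimum takes its default value +oo. *)
  apply: contrapT => nP; move: qN.
  rewrite /qpd infimum_set0 ?ltxx // => -[_ [P [hP PB _]]].
  by apply: nP; exists P.
have [l hl] := inf_finite_bounded Pb.
have P_low (i : int) : i < l -> forall x : P i, x = 0.
  by move=> il; apply/nonzeroPn => /hl; rewrite leNgt il.
have [u P_high] := bounded_above Pb PB (ex_intro _ i0 i0P).
have P_inf i : nonzero_module (P i) -> (cx_inf P <= i%:E)%E.
  exact: (infimum_le (A := [set j | nonzero_module (P j)]%classic) hl).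
have Hi0 : nonzero_module (cx_homology P i0).
  apply: contrapT => /nonzeroPn H0; have [f [g fg gf]] := aP i0 i0P.
  have : [ffun=> y0] = [ffun=> 0] :> {ffun 'I_(a i0) -> N}.
    by rewrite -[LHS]gf (H0 (g _)) -[RHS]gf (H0 (g [ffun=> 0])).
  have ai0_gt0 : (0 < a i0)%N by rewrite lt0n.
  move/ffunP => /(_ (Ordinal ai0_gt0)); rewrite !ffunE => y00.
  by rewrite y00 eqxx in y0n.
have l_low i : nonzero_module (cx_homology P i) -> l <= i.
  move=> Hi; rewrite leNgt; apply/negP => il; have /nonzeroPn := homology_zero (P_low i il).
  exact.
have ex : exists k : nat, `[< nonzero_module (cx_homology P (l + k%:Z)) >].
  exists (absz (i0 - l)); apply/asboolP; have li0 := l_low _ Hi0.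
  by have -> : l + (absz (i0 - l))%:Z = i0 by lia.
exists P, l, u, (l + (ex_minn ex)%:Z); case: ex_minnP => k /asboolP Hk kmin.
split=> // [i ik|]; last first.
  split=> // i Hi; exists (a i); apply/aP/P_inf.
  by apply: contrapT => /nonzeroPn/homology_zero/nonzeroPn.
apply/nonzeroPn => Hi; have li := l_low _ Hi.
have := kmin (absz (i - l)); rewrite leqNgt; have -> : (absz (i - l) < k)%N by lia.
move=> h; suff : false by []; apply: h; apply/asboolP.
by have -> : l + (absz (i - l))%:Z = i by lia.
Qed.

End QuasiProjective.

(** * Ext into a module of finite quasi-projective dimension *)

Section ExtOfQuasiProjective.
Import Order.TTheory.
Variables (R : comNzRingType) (m : set R).
Hypotheses (R_noeth : noetherian R) (R_local : local_ring m).
Variables M N : lmodType R.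
Hypotheses (N_nz : nonzero_module N) (qpd_fin : (qpd N < +oo)%E).
Variable X : resolution M.
Hypotheses (X_proj : projective_resolution X) (X_fg : forall n, finitely_generated (X n)).

Lemma Ext_zero_isomorphic n j (H : lmodType R) : isomorphic H {ffun 'I_n -> N} ->
  Ext_zero X N j -> Ext_zero X H j.
Proof.
move=> [f f_bij] hN; have [f_inj f_surj] := (bijectiveP f).1 f_bij.
have hf := ses_kermod f_surj.
have [s fs] : exists s : {linear {ffun 'I_n -> N} -> H}, forall y, f (s y) = y.
  have [|s sP] := ses_desc (f := idfun) hf.
    by move=> k; apply: f_inj; rewrite kermodP linear0.
  by exists s => y; have [x <-] := f_surj y; rewrite sP.
apply: (@Ext_zero_retract _ _ X _ _ j s f) (Ext_zero_ffun hN) => x.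
by apply: f_inj; rewrite fs.
Qed.

Lemma Ext_zero_of_isomorphic n j (H : lmodType R) : nonzero_module H ->
  isomorphic H {ffun 'I_n -> N} -> Ext_zero X H j -> Ext_zero X N j.
Proof.
move=> [x /eqP x0] [f f_bij] hH; have [f_inj f_surj] := (bijectiveP f).1 f_bij.
(* n = 0 would make [H] zero; otherwise the diagonal and the first coordinate make [N] a retract of
   its power. *)
case: n f f_bij f_inj f_surj => [|n] f f_bij f_inj f_surj.
  by case: x0; apply: f_inj; apply/ffunP => -[].
have [c cP] : exists c : {linear N -> {ffun 'I_n.+1 -> N}}, forall y, c y = [ffun=> y].
  apply: (@lin_of_rel _ N {ffun 'I_n.+1 -> N} (fun y z => z = [ffun=> y])) => [y|a y y' z z' -> ->|z ->].
  - by eexists.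
  - by apply/ffunP => i; rewrite !ffunE.
  - by apply/ffunP => i; rewrite !ffunE.
have [p pP] : exists p : {linear {ffun 'I_n.+1 -> N} -> N}, forall z, p z = z ord0.
  apply: (@lin_of_rel _ {ffun 'I_n.+1 -> N} N (fun z y => y = z ord0)) => [z|a z z' y y' -> ->|y ->].
  - by eexists.
  - by rewrite !ffunE.
  - by rewrite ffunE.
have [|s sP] := ses_desc (f := idfun) (ses_kermod f_surj).
  by move=> k; apply: f_inj; rewrite kermodP linear0.
apply: (@Ext_zero_retract _ _ X _ _ j (p \o f) (s \o c)) hH => y /=.
have [z zc] := f_surj (c y).
by rewrite -zc sP /= zc pP cP ffunE.
Qed.

Variables (g bnd : nat).
Hypotheses (R_van : forall j, (g < j)%N -> Ext_zero X R^o j)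
  (R_nz : ~ Ext_zero X R^o g)
  (N_bnd : forall j, (bnd <= j)%N -> Ext_zero X N j).

Lemma Ext_qpd_top : (forall j, (g < j)%N -> Ext_zero X N j) /\ ~ Ext_zero X N g.
Proof.
have [P [l [u [b [Pfg P_low P_high H_low [Hb H_iso]]]]]] := qpd_data N_nz qpd_fin.
have H_zero i j : Ext_zero X N j -> Ext_zero X (cx_homology P i) j.
  have [/H_iso[n hn]|/nonzeroPn H0] := pselect (nonzero_module (cx_homology P i)).
    exact: Ext_zero_isomorphic hn.
  by move=> _; exact: Ext_zero_triv.
have van j : (g < j)%N -> Ext_zero X N j.
  (* Descending induction from [bnd], with [n] bounding the distance: for p > g, vanishing above [p]
     forces vanishing at [p]. *)
  suff h n p : (g < p)%N -> (bnd <= p + n)%N -> Ext_zero X N p.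
    by move=> gj; apply: (h bnd) => //; exact: leq_addl.
  elim: n p => [|n IHn] p gp bp; first by apply: N_bnd; rewrite -(addn0 p).
  have [n0 hn0] := H_iso b Hb.
  apply: (Ext_zero_of_isomorphic Hb hn0).
  apply: (homology_Ext_zero R_noeth Pfg P_low P_high H_low X_proj) => [j' pj|i j' pj].
    by apply: R_van; exact: leq_trans gp pj.
  apply: H_zero; apply: IHn; first exact: ltn_trans gp pj.
  by apply: leq_trans bp _; rewrite addnS -addSn leq_add2r.
split=> // hg; apply: R_nz.
apply: (regular_Ext_zero R_noeth Pfg P_low P_high H_low X_proj Hb R_local (X_fg g) R_van) => i j.
rewrite leq_eqVlt => /orP[/eqP<-|/van]; exact: H_zero.
Qed.

End ExtOfQuasiProjective.

Theorem theorem3p8 (R : comNzRingType) (m : set R)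
    (R_noeth : noetherian R) (R_local : local_ring m)
    (M N : lmodType R)
    (M_fg : finitely_generated M) (N_fg : finitely_generated N)
    (M_nz : nonzero_module M) (N_nz : nonzero_module N)
    (Ext_fin : (Ext_sup M N < +oo)%E)
    (Gdim_fin : (Gdim M < +oo)%E) (qpd_fin : (qpd N < +oo)%E) :
  Ext_sup M N = Gdim M /\
  Gdim M = (depth m (R^o : lmodType R) - depth m M)%E.
Proof.
have ex : exists g, `[< Gdim_le g M >].
  apply: contrapT => nex; move: Gdim_fin.
  rewrite /Gdim infimum_set0 ?ltxx // => -[_ [k [Z hZ] _]].
  by apply: nex; exists k; apply/asboolP/Gdim_leP; exists Z.
have [g /asboolP Mg gmin] := ex_minnP ex.
have GdimE : Gdim M = (g%:Z)%:E.
  have gS : exists Z : resolution M, Gorenstein_resolution g Z by apply/Gdim_leP.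
  apply: infimum_eq => [|_ [k [Z hZ] <-]|z]; first by exists (g%:Z)%:E, g.
    rewrite lee_fin lez_nat; apply: gmin; apply/asboolP/Gdim_leP; by exists Z.
  by apply; exists g.
(* Minimality of [g] becomes nonvanishing of Ext^g(M, R), or of [M] itself when g = 0. *)
have g_top : Gdim_sharp g M.
  case: g Mg gmin {GdimE} => [//|k] Mk kmin hk.
  have /asboolP/kmin := Gdim_le_drop Mk hk; by rewrite ltnn.
split.
  have [X [X_proj X_fg]] := fg_free_resolution R_noeth M_fg.
  have R_van j : (g < j)%N -> Ext_zero X R^o j.
    case: j => // j gj; apply/(Ext_zeroS _ _ X_proj); exact: Gdim_le_van Mg gj.
  have R_nz : ~ Ext_zero X R^o g.
    case: g Mg g_top {gmin GdimE R_van} => [|k] Mg g_top; last by rewrite (Ext_zeroS _ _ X_proj).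
    (* For g = 0 the module [M] is reflexive and nonzero, so it has a nonzero functional. *)
    move=> /Ext_zero_Hom hM; have [x /eqP x0] := g_top; apply: x0.
    by have [_ /reflexiveP[Minj _] _] := Mg; apply: Minj => f; exact: hM.
  have [bnd N_bnd] : exists bnd, forall j, (bnd <= j)%N -> Ext_zero X N j.
    have := Ext_fin; rewrite /Ext_sup -(image_comp Posz EFin) => sup_fin.
    have [u uP] := sup_finite_bounded sup_fin.
    (* [u] may be negative; its absolute value plus one exceeds it in any case. *)
    exists (absz u).+1 => j uj; apply: contrapT => /(Ext_nonzeroE _ _ X_proj) jN.
    have : (j%:Z <= u)%R by apply: uP; exists j.
    lia.
  have [van nz] := Ext_qpd_top R_noeth R_local N_nz qpd_fin X_proj X_fg R_van R_nz N_bnd.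
  rewrite GdimE; have gE : nonzero_module (Ext M N g) by apply/(Ext_nonzeroE _ _ X_proj).
  apply: supremum_eq => [|_ [j jE <-]|z]; first by exists (g%:Z)%:E, g.
    rewrite lee_fin lez_nat leqNgt; apply/negP => /van hj.
    by move/(Ext_nonzeroE _ _ X_proj): jE.
  by apply; exists g.
have [X X_proj] := projective_resolution_exists (residue R_local).
have [d R_d] := Ext_depth_exists R_noeth X_proj.
have [gd M_d] := Gdim_Ext_depth R_noeth X_proj R_d Mg g_top.
rewrite GdimE (depth_Ext R_noeth X_proj (fg_regular R) R_d) (depth_Ext R_noeth X_proj M_fg M_d).
rewrite -EFinB; congr (_%:E); rewrite -subzn //; lia.
Qed.
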